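(* Let $(M^m,g)$ and $(N^n,h)$ be Riemannian manifolds with $m=\dim M\neq 2$, let $f:M\to(0,\infty)$ be a smooth positive function, and let $\phi:(M^m,g)\to(N^n,h)$ be a smooth map. Put $\bar g=f^{\frac{2}{m-2}}g$. Then $$\tau_{2,f}(\phi,g)=f^{\frac{m}{m-2}}\,\tau_{f^{\frac{m}{m-2}},2}(\phi,\bar g),$$ where $\tau_{2,f}(\phi,g)$ is the bi-$f$-tension field of $\phi:(M,g)\to(N,h)$ and $\tau_{f^{m/(m-2)},2}(\phi,\bar g)$ is the $f^{\frac{m}{m-2}}$-bitension field of $\phi:(M,\bar g)\to(N,h)$. In particular, $\phi:(M^m,g)\to(N^n,h)$ is bi-$f$-harmonic if and only if $\phi:(M^m,f^{\frac{2}{m-2}}g)\to(N^n,h)$ is $f^{\frac{m}{m-2}}$-biharmonic. Conversely, $\phi:(M^m,g)\to(N^n,h)$ is $f$-biharmonic if and only if $\phi:(M^m,f^{-\frac{2}{m}}g)\to(N^n,h)$ is bi-$f^{\frac{m-2}{m}}$-harmonic.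
   Context: All manifolds, maps and functions are smooth. For a smooth map $\phi:(M,g)\to(N,h)$ between Riemannian manifolds, $\nabla^\phi$ is the connection on $\phi^{-1}TN$ induced by the Levi-Civita connection of $N$, and $R^N(X,Y)Z=[\nabla^N_X,\nabla^N_Y]Z-\nabla^N_{[X,Y]}Z$. The tension field is $\tau(\phi)=\mathrm{Tr}_g\nabla d\phi$. The Jacobi operator on sections $X$ of $\phi^{-1}TN$ is $J^\phi(X)=-\mathrm{Tr}_g[\nabla^\phi\nabla^\phi X-\nabla^\phi_{\nabla^M}X-R^N(d\phi,X)d\phi]$, i.e. $-\sum_i\{\nabla^\phi_{e_i}\nabla^\phi_{e_i}X-\nabla^\phi_{\nabla^M_{e_i}e_i}X-R^N(d\phi(e_i),X)d\phi(e_i)\}$ for a local $g$-orthonormal frame $(e_i)$. The bitension field is $\tau_2(\phi)=-J^\phi(\tau(\phi))$. For a positive function $f$ on $M$: the $f$-tension field is $\tau_f(\phi)=f\tau(\phi)+d\phi(\mathrm{grad} f)$; the bi-$f$-tension field is $\tau_{2,f}(\phi)=-fJ^\phi(\tau_f(\phi))+\nabla^\phi_{\mathrm{grad} f}\tau_f(\phi)$; the $f$-bitension field is $\tau_{f,2}(\phi)=f\tau_2(\phi)+(\Delta f)\tau(\phi)+2\nabla^\phi_{\mathrm{grad} f}\tau(\phi)$, with $\Delta=\mathrm{div}\,\mathrm{grad}$. All of these depend on the metric of the domain; when it needs emphasis it is written as a second argument, as in $\tau_{2,f}(\phi,g)$. The map $\phi$ is bi-$f$-harmonic if $\tau_{2,f}(\phi)=0$,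 and $f$-biharmonic if $\tau_{f,2}(\phi)=0$; these are the Euler-Lagrange equations of $\frac12\int|\tau_f(\phi)|^2v_g$ and $\frac12\int f|\tau(\phi)|^2v_g$ respectively. *)

(* Defs.v *)
From HB Require Import structures.
From mathcomp Require Import all_boot all_order all_algebra.
From mathcomp Require Import all_classical all_reals all_analysis.

Set Implicit Arguments.
Unset Strict Implicit.
Unset Printing Implicit Defensive.

Import Order.TTheory GRing.Theory Num.Theory.
Import numFieldNormedType.Exports.

Local Open Scope classical_set_scope.
Local Open Scope ring_scope.

(* Tangent vectors and points of R^m are row vectors. *)
Definition bvec (R : realType) m (i : 'I_m) : 'rV[R]_m := delta_mx 0 i.

Definition partial (R : realType) m (W : normedModType R) (i : 'I_m)
    (F : 'rV[R]_m -> W) (y : 'rV[R]_m) : W :=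
  'D_(bvec R i) F y.

Fixpoint Ck (R : realType) m (k : nat) (U : set 'rV[R]_m)
    (F : 'rV[R]_m -> R) : Prop :=
  (forall y, U y -> {for y, continuous F}) /\
  if k is k'.+1 then
    forall i, (forall y, U y -> derivable F y (bvec R i)) /\
              Ck k' U (partial i F)
  else True.

Definition smooth_on (R : realType) m (U : set 'rV[R]_m)
    (F : 'rV[R]_m -> R) : Prop :=
  forall k, Ck k U F.

Section SmoothOn.
Variables (R : realType) (m : nat) (U : set 'rV[R]_m).
Hypothesis oU : open U.
Implicit Types F G : 'rV[R]_m -> R.

Lemma near_on F G : (forall y, U y -> F y = G y) ->
  forall y, U y -> \forall z \near y, F z = G z.
Proof. by move=> FG y Uy; apply: filterS (open_nbhs_nbhs (conj oU Uy)). Qed.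

Lemma eq_cont F G y : (forall y, U y -> F y = G y) -> U y ->
  {for y, continuous F} -> {for y, continuous G}.
Proof.
move=> FG Uy; rewrite /prop_for /continuous_at -FG// => cF.
apply: cvg_trans cF; apply: (@near_eq_cvg _ _ (nbhs y)).
exact: (near_on FG Uy).
Qed.

Lemma eq_Ck k F G : (forall y, U y -> F y = G y) -> Ck k U F -> Ck k U G.
Proof.
elim: k F G => [|k IHk] F G FG /= [cF dF]; split=> //.
- by move=> y Uy; apply: eq_cont FG Uy (cF _ Uy).
- by move=> y Uy; apply: eq_cont FG Uy (cF _ Uy).
move=> i; have [dFi CFi] := dF i; split=> [y Uy|].
  by apply: near_eq_derivable (dFi _ Uy); exact: (near_on FG Uy).
by apply: IHk CFi => y Uy; apply: near_eq_derive; exact: (near_on FG Uy).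
Qed.

Lemma CkS k F : Ck k.+1 U F -> Ck k U F.
Proof.
elim: k F => [|k IHk] F [cF dF]; split=> // i.
by have [dFi CFi] := dF i; split=> //; apply: IHk.
Qed.

Lemma CkD k F G : Ck k U F -> Ck k U G -> Ck k U (fun y => F y + G y).
Proof.
elim: k F G => [|k IHk] F G [cF dF] [cG dG]; split=> //.
- by move=> y Uy; exact: (cvgD (cF y Uy) (cG y Uy)).
- by move=> y Uy; exact: (cvgD (cF y Uy) (cG y Uy)).
move=> i; have [dFi CFi] := dF i; have [dGi CGi] := dG i; split=> [y Uy|].
  by apply: derivableD; [apply: dFi|apply: dGi].
apply: eq_Ck (IHk _ _ CFi CGi) => y Uy.
by rewrite [RHS]deriveD//; [apply: dFi|apply: dGi].
Qed.

Lemma CkM k F G : Ck k U F -> Ck k U G -> Ck k U (fun y => F y * G y).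
Proof.
elim: k F G => [|k IHk] F G CF CG; have [cF dF] := CF; have [cG dG] := CG.
  by split=> // y Uy; exact: (cvgM (cF y Uy) (cG y Uy)).
split=> [y Uy|i]; first by exact: (cvgM (cF y Uy) (cG y Uy)).
have [dFi CFi] := dF i; have [dGi CGi] := dG i; split=> [y Uy|].
  by apply: derivableM; [apply: dFi|apply: dGi].
have := CkD (IHk _ _ (CkS CF) CGi) (IHk _ _ (CkS CG) CFi).
apply: eq_Ck => y Uy.
by rewrite [RHS]deriveM//; [apply: dFi|apply: dGi].
Qed.

Lemma Ck_cst k (c : R) : Ck k U (fun=> c).
Proof.
elim: k c => [|k IHk] c; split=> //.
- by move=> y Uy; exact: cst_continuous.
- by move=> y Uy; exact: cst_continuous.
move=> i; split=> [y Uy|]; first exact: derivable_cst.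
by apply: eq_Ck (IHk 0) => y Uy; rewrite [RHS]derive_cst.
Qed.

Lemma is_derive_powR_comp F (a : R) y v : 0 < F y -> derivable F y v ->
  is_derive y v (fun z => F z `^ a) (a * F y `^ (a - 1) * 'D_v F y).
Proof.
move=> Fy dF.
pose phi (h : R) := F (h *: v + y).
have phi0 : phi 0 = F y by rewrite /phi scale0r add0r.
have dphi : derivable phi 0 1 by apply/(derivable1P F y v).
have ephi (G : 'rV[R]_m -> R) : 'D_v G y = 'D_1 (fun h : R => G (h *: v + y)) 0.
  rewrite /derive; congr (lim (_ @ 0^')); apply/funext => h /=.
  by rewrite addr0 scale0r add0r [_%:A]mulr1.
have dpow : derivable (fun x : R => x `^ a) (phi 0) 1.
  by rewrite phi0; apply: derivable_powR; rewrite in_itv/= andbT.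
split.
  apply/derivable1P; apply/derivable1_diffP.
  apply: (@differentiable_comp _ _ _ _ phi (fun x : R => x `^ a)).
    exact/derivable1_diffP.
  exact/derivable1_diffP.
rewrite (ephi (fun z => F z `^ a)) (ephi F) -!derive1E.
have -> : (fun h : R => F (h *: v + y) `^ a) = (fun x : R => x `^ a) \o phi by [].
by rewrite derive1_comp// powR_derive1 ?phi0// in_itv/= andbT.
Qed.

Lemma Ck_powR k F (a : R) : (forall y, U y -> 0 < F y) ->
  Ck k U F -> Ck k U (fun y => F y `^ a).
Proof.
move=> F0; elim: k a => [|k IHk] a CF; have [cF dF] := CF.
  split=> // y Uy; apply: (@continuous_comp _ _ _ F (fun x : R => x `^ a)).
    exact: (cF y Uy).
  apply: differentiable_continuous; apply/derivable1_diffP.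
  by apply: derivable_powR; rewrite in_itv/= andbT F0.
split=> [y Uy|i].
  apply: (@continuous_comp _ _ _ F (fun x : R => x `^ a)); first exact: (cF y Uy).
  apply: differentiable_continuous; apply/derivable1_diffP.
  by apply: derivable_powR; rewrite in_itv/= andbT F0.
have [dFi CFi] := dF i.
have dpow y : U y -> _ := fun Uy => is_derive_powR_comp a (F0 y Uy) (dFi y Uy).
split=> [y /dpow [] //|].
have := CkM (CkM (Ck_cst k a) (IHk (a - 1) (CkS CF))) CFi.
by apply: eq_Ck => y /dpow [_ <-].
Qed.

End SmoothOn.

(* [coord] and [param] are total functions; only their values on [dom] and on
   the image [cimg] of [dom] matter. *)
Record chart (R : realType) m (M : topologicalType) := Chart {
  dom : set M;
  coord : M -> 'rV[R]_m;
  param : 'rV[R]_m -> M;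
  dom_open : open dom;
  cimg_open : open (coord @` dom);
  coordK : forall p, dom p -> param (coord p) = p;
  coord_cont : forall p, dom p -> {for p, continuous coord};
  param_cont : forall p, dom p -> {for coord p, continuous param} }.

Definition cimg (R : realType) m (M : topologicalType) (c : chart R m M) :
  set 'rV[R]_m := coord c @` dom c.

Record manifold (R : realType) (m : nat) := Manifold {
  pts :> topologicalType;
  atlas : set (chart R m pts);
  mfd_hausdorff : hausdorff_space pts;
  mfd_second_countable : @second_countable pts;
  mfd_cover : forall p : pts, exists2 c, atlas c & dom c p;
  mfd_compat : forall c d, atlas c -> atlas d -> forall k,
    smooth_on (coord c @` (dom c `&` dom d))
              (fun y => coord d (param c y) 0 k) }.

(* Row i is the coordinate field d/dx^i of [c] at [p], in the coordinates of
   [d]. *)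
Definition transition_mx (R : realType) m (M : manifold R m)
    (c d : chart R m M) (p : M) : 'M[R]_m :=
  \matrix_(i, k) partial i (fun y => coord d (param c y) 0 k) (coord c p).

(* [gram c p] is the matrix of g_p in the coordinate basis of [c]. *)
Record metric (R : realType) m (M : manifold R m) := Metric {
  gram : chart R m M -> M -> 'M[R]_m;
  gram_sym : forall c p, atlas c -> dom c p -> (gram c p)^T = gram c p;
  gram_pos : forall c p (v : 'rV[R]_m), atlas c -> dom c p -> v != 0 ->
    0 < (v *m gram c p *m v^T) 0 0;
  gram_smooth : forall c i j, atlas c ->
    smooth_on (cimg c) (fun y => gram c (param c y) i j);
  gram_transition : forall c d p, atlas c -> atlas d -> dom c p -> dom d p ->
    gram c p =
    transition_mx c d p *m gram d p *m (transition_mx c d p)^T }.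

Record smap (R : realType) m n (M : manifold R m) (N : manifold R n) := SMap {
  smap_fun :> M -> N;
  smap_cont : continuous smap_fun;
  smap_smooth : forall c d, atlas c -> atlas d -> forall a,
    smooth_on (coord c @` (dom c `&` smap_fun @^-1` dom d))
              (fun y => coord d (smap_fun (param c y)) 0 a) }.

Record posfun (R : realType) m (M : manifold R m) := PosFun {
  posfun_fun :> M -> R;
  posfun_gt0 : forall p, 0 < posfun_fun p;
  posfun_smooth : forall c, atlas c ->
    smooth_on (cimg c) (fun y => posfun_fun (param c y)) }.

Section PowConformal.
Variables (R : realType) (m : nat) (M : manifold R m).

Lemma pospow_gt0 (f : posfun M) (a : R) p : 0 < f p `^ a.
Proof. exact/powR_gt0/posfun_gt0. Qed.

Lemma pospow_smooth (f : posfun M) (a : R) c : atlas c ->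
  smooth_on (cimg c) (fun y => f (param c y) `^ a).
Proof.
move=> Ac k; apply: Ck_powR (posfun_smooth f Ac k); first exact: cimg_open.
by move=> y _; apply: posfun_gt0.
Qed.

Definition pospow (f : posfun M) (a : R) : posfun M :=
  PosFun (pospow_gt0 f a) (pospow_smooth f a).

Variables (l : posfun M) (g : metric M).

Let cgram (c : chart R m M) (p : M) : 'M[R]_m := l p *: gram g c p.

Lemma conformal_sym c p : atlas c -> dom c p -> (cgram c p)^T = cgram c p.
Proof. by move=> Ac cp; rewrite /cgram linearZ/= gram_sym. Qed.

Lemma conformal_pos c p (v : 'rV[R]_m) : atlas c -> dom c p -> v != 0 ->
  0 < (v *m cgram c p *m v^T) 0 0.
Proof.
move=> Ac cp v0; rewrite /cgram -scalemxAr -scalemxAl mxE.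
by rewrite mulr_gt0 ?posfun_gt0// gram_pos.
Qed.

Lemma conformal_smooth c i j : atlas c ->
  smooth_on (cimg c) (fun y => cgram c (param c y) i j).
Proof.
move=> Ac k.
have := CkM (@cimg_open _ _ _ c) (posfun_smooth l Ac k)
            (gram_smooth g i j Ac k).
by apply: eq_Ck => [|y _]; [exact: cimg_open|rewrite mxE].
Qed.

Lemma conformal_transition c d p : atlas c -> atlas d -> dom c p -> dom d p ->
  cgram c p = transition_mx c d p *m cgram d p *m (transition_mx c d p)^T.
Proof.
move=> Ac Ad cp dp; rewrite /cgram (gram_transition g Ac Ad cp dp).
by rewrite -scalemxAr -scalemxAl.
Qed.

Definition conformal : metric M :=
  Metric conformal_sym conformal_pos conformal_smooth conformal_transition.

End PowConformal.

(* Riemannian geometry in one pair of charts: [G] and [H] are the matrices of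
   the metrics of the domain and of the target in the coordinates of the charts,
   [Phi] is the map, and vector fields are their coefficients in the coordinate
   frame. *)
Section Local.
Variables (R : realType) (m n : nat).

Definition cframe k (i : 'I_k) : 'rV[R]_k -> 'rV[R]_k := fun=> bvec R i.

(* V(F) = sum_i V^i d_i F; for a map F this is dF(V). *)
Definition along k (W : normedModType R) (V : 'rV[R]_k -> 'rV[R]_k)
    (F : 'rV[R]_k -> W) (y : 'rV[R]_k) : W :=
  \sum_i V y 0 i *: partial i F y.

Definition bracket k (V W : 'rV[R]_k -> 'rV[R]_k) (y : 'rV[R]_k) : 'rV[R]_k :=
  along V W y - along W V y.

(* Gamma^l_ij *)
Definition christoffel k (G : 'rV[R]_k -> 'M[R]_k) (y : 'rV[R]_k)
    (l i j : 'I_k) : R :=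
  2^-1 * \sum_s invmx (G y) l s *
    (partial i (fun z => G z j s) y + partial j (fun z => G z i s) y
     - partial s (fun z => G z i j) y).

Definition chr_form k (G : 'rV[R]_k -> 'M[R]_k) (y u v : 'rV[R]_k) :
    'rV[R]_k :=
  \row_l \sum_i \sum_j christoffel G y l i j * u 0 i * v 0 j.

(* Levi-Civita connection *)
Definition nabla k (G : 'rV[R]_k -> 'M[R]_k) (V W : 'rV[R]_k -> 'rV[R]_k)
    (y : 'rV[R]_k) : 'rV[R]_k :=
  along V W y + chr_form G y (V y) (W y).

(* R(u,v)w, computed on the constant-coefficient extensions of u, v, w *)
Definition curvature k (G : 'rV[R]_k -> 'M[R]_k) (y u v w : 'rV[R]_k) :
    'rV[R]_k :=
  let U : 'rV[R]_k -> 'rV[R]_k := fun=> u in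
  let V : 'rV[R]_k -> 'rV[R]_k := fun=> v in
  let W : 'rV[R]_k -> 'rV[R]_k := fun=> w in
  nabla G U (nabla G V W) y - nabla G V (nabla G U W) y
  - nabla G (bracket U V) W y.

Definition trace_g k (W : normedModType R) (G : 'rV[R]_k -> 'M[R]_k)
    (B : 'I_k -> 'I_k -> W) (y : 'rV[R]_k) : W :=
  \sum_i \sum_j invmx (G y) i j *: B i j.

Definition grad k (G : 'rV[R]_k -> 'M[R]_k) (f : 'rV[R]_k -> R)
    (y : 'rV[R]_k) : 'rV[R]_k :=
  \row_i \sum_j invmx (G y) i j * partial j f y.

Definition divergence k (G : 'rV[R]_k -> 'M[R]_k) (V : 'rV[R]_k -> 'rV[R]_k)
    (y : 'rV[R]_k) : R :=
  \sum_i nabla G (cframe i) V y 0 i.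

Definition laplacian k (G : 'rV[R]_k -> 'M[R]_k) (f : 'rV[R]_k -> R) :
    'rV[R]_k -> R :=
  divergence G (grad G f).

Variables (G : 'rV[R]_m -> 'M[R]_m) (H : 'rV[R]_n -> 'M[R]_n).
Variable Phi : 'rV[R]_m -> 'rV[R]_n.

(* The connection induced on the pull-back of the tangent bundle. *)
Definition pnabla (V : 'rV[R]_m -> 'rV[R]_m) (X : 'rV[R]_m -> 'rV[R]_n)
    (y : 'rV[R]_m) : 'rV[R]_n :=
  along V X y + chr_form H (Phi y) (along V Phi y) (X y).

Definition loc_tension (y : 'rV[R]_m) : 'rV[R]_n :=
  trace_g G (fun i j =>
    pnabla (cframe i) (along (cframe j) Phi) y
    - along (nabla G (cframe i) (cframe j)) Phi y) y.

Definition loc_jacobi (X : 'rV[R]_m -> 'rV[R]_n) (y : 'rV[R]_m) : 'rV[R]_n :=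
  - trace_g G (fun i j =>
      pnabla (cframe i) (pnabla (cframe j) X) y
      - pnabla (nabla G (cframe i) (cframe j)) X y
      - curvature H (Phi y) (along (cframe i) Phi y) (X y)
          (along (cframe j) Phi y)) y.

Definition loc_bitension (y : 'rV[R]_m) : 'rV[R]_n :=
  - loc_jacobi loc_tension y.

Variable f : 'rV[R]_m -> R.

Definition loc_f_tension (y : 'rV[R]_m) : 'rV[R]_n :=
  f y *: loc_tension y + along (grad G f) Phi y.

Definition loc_bi_f_tension (y : 'rV[R]_m) : 'rV[R]_n :=
  - (f y *: loc_jacobi loc_f_tension y) + pnabla (grad G f) loc_f_tension y.

Definition loc_f_bitension (y : 'rV[R]_m) : 'rV[R]_n :=
  f y *: loc_bitension y + laplacian G f y *: loc_tension y
  + 2 *: pnabla (grad G f) loc_tension y.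

End Local.

(* A vector field along a map M -> N is given by its coefficients at each point
   [p], in the coordinate basis of the chart [d] of N, the local expression being
   computed with the chart [c] of M. Only the values at charts [c], [d] of the
   atlases with [p] in [dom c] and [phi p] in [dom d] matter. *)
Definition field_along (R : realType) m n (M : manifold R m)
    (N : manifold R n) : Type :=
  chart R m M -> chart R n N -> M -> 'rV[R]_n.

Section Global.
Variables (R : realType) (m n : nat) (M : manifold R m) (N : manifold R n).

Definition field_eq (phi : smap M N) (X Y : field_along M N) : Prop :=
  forall c d p, atlas c -> atlas d -> dom c p -> dom d (phi p) ->
    X c d p = Y c d p.

Definition field0 : field_along M N := fun _ _ _ => 0.

Definition field_scale (l : M -> R) (X : field_along M N) : field_along M N :=
  fun c d p => l p *: X c d p.

Definition metric_in (k : nat) (P : manifold R k) (g : metric P)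
    (c : chart R k P) (y : 'rV[R]_k) : 'M[R]_k := gram g c (param c y).

Definition map_in (phi : smap M N) (c : chart R m M) (d : chart R n N)
    (y : 'rV[R]_m) : 'rV[R]_n := coord d (phi (param c y)).

Definition fun_in (f : posfun M) (c : chart R m M) (y : 'rV[R]_m) : R :=
  f (param c y).

Definition bi_f_tension (f : posfun M) (phi : smap M N)
    (g : metric M) (h : metric N) : field_along M N :=
  fun c d p => loc_bi_f_tension (metric_in g c) (metric_in h d)
                 (map_in phi c d) (fun_in f c) (coord c p).

Definition f_bitension (f : posfun M) (phi : smap M N)
    (g : metric M) (h : metric N) : field_along M N :=
  fun c d p => loc_f_bitension (metric_in g c) (metric_in h d)
                 (map_in phi c d) (fun_in f c) (coord c p).

Definition bi_f_harmonic (f : posfun M) (phi : smap M N)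
    (g : metric M) (h : metric N) : Prop :=
  field_eq phi (bi_f_tension f phi g h) field0.

Definition f_biharmonic (f : posfun M) (phi : smap M N)
    (g : metric M) (h : metric N) : Prop :=
  field_eq phi (f_bitension f phi g h) field0.

End Global.

(* Main.v *)
(* With L = f^(2/(m-2)), F = f^(m/(m-2)) = f L and gbar = L g, the traced
   Christoffel symbols Gamma^l = g^ij Gamma^l_ij satisfy
   F Gamma(gbar) = f Gamma(g) - grad_g f, while F tr_gbar = f tr_g. Hence
   tau_f(phi, g) = F tau(phi, gbar), and f J - nabla_(grad f) for g is F J for
   gbar, so that tau_(2,f)(phi, g) = - F J(F tau) with J and tau taken for gbar.
   The Leibniz rule J(F X) = F J(X) - (Delta F) X - 2 nabla_(grad F) X turns the
   right-hand side into F times the F-bitension field. The converse statement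
   is the first one for the metric f^(-2/m) g and the function f^((m-2)/m). *)
Require Import Defs.
From mathcomp Require Import all_boot all_order all_algebra.
From mathcomp Require Import ring.
From mathcomp Require Import all_classical all_reals all_analysis.

Set Implicit Arguments.
Unset Strict Implicit.
Unset Printing Implicit Defensive.

Import Order.TTheory GRing.Theory Num.Theory.
Import numFieldNormedType.Exports.

Local Open Scope classical_set_scope.
Local Open Scope ring_scope.

(** * Differentiability and smoothness of compositions and inverse matrices *)

Section Differentiability.
Variable R : realType.

(** The exponents are forced. For gbar = L g the traced Christoffel field becomes L^(-1) (Gamma +
    (2-m)/(2L) grad L), and F tr_gbar = f tr_g demands F = f L. Hence F Gamma(gbar) differs from f
    Gamma(g) by f (2-m)/(2L) grad L, which is - grad f exactly when d log f = (m-2)/2 d log L; up to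
    a constant factor this is L = f^(2/(m-2)). In dimension 2 the correction vanishes and no choice
    of L can produce grad f. The analytic obstacle is the notion of smoothness: [Ck] speaks of
    iterated partial derivatives only, whereas the Christoffel symbols of N composed with the map
    call for a chain rule. That rule rests on the differentiability of C^1 functions, obtained from
    mean value estimates. The algebraic obstacle is the Laplacian: it is defined as the divergence
    of the gradient, while the Leibniz rule produces a trace of second derivatives, and an index
    identity must match the two. The exponents of the converse have denominator m, so m = 0 needs
    its own argument. *)

Lemma ler_norm_coord n (x : 'rV[R]_n) i : `|x 0 i| <= `|x|.
Proof.
rewrite [leRHS]/Num.Def.normr/= mx_normrE.
exact: (le_bigmax _ (fun ij => `|x ij.1 ij.2|) (0, i)).
Qed.

Lemma norm_rV_le n (x : 'rV[R]_n) e : 0 <= e ->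
  (forall i, `|x 0 i| <= e) -> `|x| <= e.
Proof.
move=> e0 xe; rewrite [leLHS]/Num.Def.normr/= mx_normrE.
by apply: bigmax_le => // -[i j] _; rewrite ord1.
Qed.

Lemma is_derive_line (V W : normedModType R) (F : V -> W) z v (s : R) :
  derivable F (s *: v + z) v ->
  is_derive s 1 (fun t => F (t *: v + z)) ('D_v F (s *: v + z)).
Proof.
have E : (fun h : R => h^-1 *: (F ((h *: 1%R + s) *: v + z) - F (s *: v + z))) =
         (fun h : R => h^-1 *: (F (h *: v + (s *: v + z)) - F (s *: v + z))).
  by apply/funext => h; rewrite [_%:A]mulr1 scalerDl addrA.
by move=> dF; split; rewrite /derivable /derive E.
Qed.

(** The mean value theorem is applied on [0, t] or [t, 0]; asking for the bound on the symmetric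
    range [|s| <= |t|] covers both signs of t. *)
Lemma line_increment (V : normedModType R) (F : V -> R) z v (e t : R) :
  (forall s, `|s| <= `|t| ->
     derivable F (s *: v + z) v /\ `|'D_v F (s *: v + z)| <= e) ->
  `|F (t *: v + z) - F z| <= e * `|t|.
Proof.
move=> Ht.
have Hin (a b s : R) : `|a| <= `|t| -> `|b| <= `|t| -> a <= s <= b -> `|s| <= `|t|.
  by rewrite !ler_norml => /andP[? _] /andP[_ ?] /andP[? ?]; apply/andP; split;
    [apply: le_trans|apply: le_trans] ; eauto.
have MV (a b : R) : a <= b -> `|a| <= `|t| -> `|b| <= `|t| ->
    `|F (b *: v + z) - F (a *: v + z)| <= e * (b - a).
  move=> ab at_ bt.
  have [|||c cab ->] := @MVT_segment R (fun s => F (s *: v + z))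
     (fun s => 'D_v F (s *: v + z)) a b => //.
  - move=> s; rewrite in_itv/= => /andP[/ltW a_s /ltW sb].
    by apply: is_derive_line; apply: (Ht _ _).1; apply: (Hin a b) => //; apply/andP.
  - apply: derivable_within_continuous => s; rewrite in_itv/= => sab.
    have [] // := @is_derive_line _ _ F z v s.
    by apply: (Ht _ _).1; apply: (Hin a b).
  - rewrite normrM [`|b - a|]ger0_norm ?subr_ge0// ler_wpM2r ?subr_ge0//.
    by apply: (Ht _ _).2; apply: (Hin a b) => //; move: cab; rewrite in_itv.
have [t0|t0] := leP 0 t.
  have := MV 0 t t0; rewrite scale0r add0r subr0 {4}(ger0_norm t0).
  by apply; rewrite ?normr0 ?normr_ge0.
have := MV t 0 (ltW t0); rewrite scale0r add0r sub0r distrC (ltr0_norm t0).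
by apply; rewrite ?normr0// oppr_ge0 ltW.
Qed.

(* The increment is telescoped along the coordinate directions; the mean value
   theorem bounds each step. *)
Lemma rV_increment n (F : 'rV[R]_n -> R) y (r e : R) :
  0 <= e ->
  (forall z i, `|z| <= r ->
    derivable F (z + y) (bvec R i) /\ `|partial i F (z + y)| <= e) ->
  forall h, `|h| <= r -> `|F (h + y) - F y| <= n%:R * e * `|h|.
Proof.
move=> e0 HF h hr.
pose hk k : 'rV[R]_n := \row_i (if (i < k)%N then h 0 i else 0).
have hk_n : hk n = h by apply/rowP => i; rewrite mxE ltn_ord.
suff H k : (k <= n)%N -> `|F (hk k + y) - F y| <= k%:R * e * `|h|.
  by have := H n (leqnn n); rewrite hk_n.
elim: k => [_|k IH kn].
  have -> : hk 0%N = 0 by apply/rowP => i; rewrite !mxE.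
  by rewrite add0r subrr normr0 !mul0r.
pose i := Ordinal kn.
have hS : hk k.+1 + y = h 0 i *: bvec R i + (hk k + y).
  rewrite addrA; congr (_ + _); apply/rowP => j; rewrite !mxE/=.
  rewrite eq_sym -val_eqE/= ltnS leq_eqVlt eq_sym.
  have [kj|kj] := eqVneq k j; last by rewrite /= mulr0 add0r.
  rewrite /= -kj ltnn mulr1 addr0; congr (h 0 _); exact/val_inj.
rewrite hS -(subrKA (F (hk k + y))) (le_trans (ler_normD _ _))//.
rewrite -natr1 mulrDl mulrDl addrC mul1r lerD//; first exact/IH/ltnW.
rewrite (@le_trans _ _ (e * `|h 0 i|))//; last first.
  by rewrite ler_wpM2l// ler_norm_coord.
apply: line_increment => s st; rewrite addrA; apply: HF.
apply: (le_trans _ hr); apply: norm_rV_le => // j; rewrite !mxE/=.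
have [->|ji] := eqVneq j i.
  by rewrite /= ltnn mulr1 addr0 (le_trans st)// ler_norm_coord.
rewrite mulr0 add0r; case: ifP => _; last by rewrite normr0.
exact: ler_norm_coord.
Qed.

(** The linear map [P] with the partials of [F] at y is subtracted. The partials of [E = F - P]
    vanish at y and are small nearby by continuity, so [rV_increment] bounds the increment of [E] by
    a little-o of h, and [E] has differential zero. *)
Lemma Ck1_differentiable n (V : set 'rV[R]_n) (F : 'rV[R]_n -> R) y :
  open V -> V y -> Ck 1 V F -> differentiable F y.
Proof.
move=> oV Vy [_ CF].
pose P (z : 'rV[R]_n) : R := \sum_i partial i F y * z 0 i.
have dP z : differentiable P z.
  have -> : P = \sum_i (fun z : 'rV[R]_n => partial i F y * z 0 i).
    by apply/funext => w; rewrite fct_sumE.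
  apply: differentiable_sum => i.
  by apply: differentiableZ; exact: differentiable_coord.
have DP z i : 'D_(bvec R i) P z = partial i F y.
  rewrite /derive; apply: cvg_lim => //.
  apply: (@cvg_trans _ ((fun=> partial i F y) @ (0 : R)^')); last exact: cvg_cst.
  apply: near_eq_cvg; near=> t.
  have t0 : t != 0 by near: t; exact: nbhs_dnbhs_neq.
  rewrite /P -sumrB (bigD1 i)//= big1 => [|j ji]; rewrite !mxE/=.
    rewrite eqxx mulr1 mulrDr addrK addr0 [_ *: _]mulrCA.
    by rewrite mulVf ?mulr1.
  by rewrite (negPf ji) mulr0 add0r subrr.
pose E z := F z - P z.
have EFP : E = F - P by [].
have CE i : {for y, continuous (partial i F)} by have [_ [c _]] := CF i; exact: c.
suff dE : differentiable E y.
  have -> : F = E + P by apply/funext => z; rewrite /E fctE subrK.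
  exact: differentiableD.
have Eo : E \o shift y = cst (E y) + \0 +o_ (0 : 'rV[R]_n) id.
  apply/eqaddoP => _/posnumP[e]; rewrite addr0.
  (* [rV_increment] costs a factor n; the denominator n + 1 absorbs it and is nonzero even for n =
     0. *)
  pose e' := e%:num / n.+1%:R.
  have e'0 : 0 < e' by rewrite divr_gt0.
  have nV : \forall z \near y, V z by exact: open_nbhs_nbhs.
  have nE : \forall z \near y, forall i : 'I_n,
      `|partial i F y - partial i F z| <= e'.
    have := @filter_forall _ 'I_n
      (fun i z => is_true (`|partial i F y - partial i F z| <= e')) (nbhs y) _.
    by apply=> i; have /cvgrPdist_le := CE i; exact.
  have [r /= r0 Hr] := (@nbhs_ballP R 'rV[R]_n _ _).1 (filterI nV nE).
  (* The radius is halved because [rV_increment] works on a closed ball and [Hr] on an open one. *)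
  have Hinc := @rV_increment n E y (r / 2) e' (ltW e'0) _.
  near=> h; rewrite /cst/= fctE [leLHS](_ : _ = `|E (h + y) - E y|); last first.
    by congr (`|_|); rewrite addrC.
  apply: (@le_trans _ _ (n%:R * e' * `|h|)); first apply: Hinc.
  - move=> z i zr; have [|Vz Hz] := Hr (z + y).
      rewrite -ball_normE/= opprD addrCA subrr addr0 normrN.
      by rewrite (le_lt_trans zr)// ltr_pdivrMr// ltr_pMr// ltr1n.
    have dFz : derivable F (z + y) (bvec R i) by apply: (CF i).1.
    have dPz : derivable P (z + y) (bvec R i) by exact: diff_derivable.
    split; first exact: derivableB.
    have -> : partial i E (z + y) = partial i F (z + y) - partial i F y.
      by rewrite -(DP (z + y) i); exact: deriveB.
    by rewrite distrC; exact: Hz.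
  - by near: h; apply: cvgr0_norm_le => //; exact: divr_gt0.
  - rewrite ler_wpM2r// /e' mulrCA ger_pMr// ler_pdivrMr// mul1r ler_nat.
    exact: leqnSn.
have E0 : continuous (\0 : 'rV[R]_n -> R) by exact: cst_continuous.
by apply/diff_locallyP; rewrite (diff_unique E0 Eo).
Unshelve. all: by end_near. Qed.


(** [P] is only known to have a derivative in the direction v, so the chain rule for differentials
    is applied to the curve [g], the restriction of [P] to the line through y. *)
Lemma is_derive_comp (V : normedModType R) n (F : 'rV[R]_n -> R)
    (P : V -> 'rV[R]_n) y v :
  differentiable F (P y) -> derivable P y v ->
  is_derive y v (F \o P)
    (\sum_a partial a F (P y) * 'D_v (fun z => P z 0 a) y).
Proof.
move=> dF dP.
pose g (t : R) := P (t *: v + y).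
have g0 : g 0 = P y by rewrite /g scale0r add0r.
have dg : derivable g 0 1 by exact: (derivable1P P y v).1.
have dfg : differentiable (F \o g) 0.
  apply: differentiable_comp; first by apply/derivable1_diffP.
  by rewrite g0.
have shift0 (W : normedModType R) (G : V -> W) :
    'D_v G y = 'D_1 (fun t : R => G (t *: v + y)) 0.
  rewrite /derive; congr (lim (_ @ 0^')); apply/funext => h /=.
  by rewrite addr0 scale0r add0r [_%:A]mulr1.
split; first by apply/derivable1P/derivable1_diffP.
rewrite shift0 deriveE// (_ : (fun _ => _) = F \o g)// diff_comp ?g0//; last first.
  exact/derivable1_diffP.
rewrite /= -[X in 'd F _ X]deriveE; last exact/derivable1_diffP.
rewrite -shift0 [X in 'd F _ X]row_sum_delta linear_sum; apply: eq_bigr => a _.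
have -> : 'D_v (fun z => P z 0 a) y = 'D_v P y 0 a by rewrite (derive_mx dP) mxE.
rewrite linearZ /partial [X in X * _]deriveE; last exact: dF.
exact: mulrC.
Qed.

End Differentiability.

(** * Closure of [Ck] under composition, inversion and matrix inverse *)

Section Smooth.
Variable R : realType.

Lemma continuous_rV (T : topologicalType) n (P : T -> 'rV[R]_n) y :
  (forall a, {for y, continuous (fun z => P z 0 a)}) -> {for y, continuous P}.
Proof.
move=> cP; apply/cvgrPdist_le => e e0.
have H := @filter_forall _ 'I_n
  (fun a z => is_true (`|P y 0 a - P z 0 a| <= e)) (nbhs y) _.
have {H} : \forall z \near y, forall a, `|P y 0 a - P z 0 a| <= e.
  by apply: H => a; have /cvgrPdist_le := cP a; exact.
apply: filterS => z Pz; apply: norm_rV_le; first exact: ltW.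
by move=> a; rewrite !mxE.
Qed.

Lemma Ck_le m (U : set 'rV[R]_m) (F : 'rV[R]_m -> R) k j :
  (j <= k)%N -> Ck k U F -> Ck j U F.
Proof.
by move=> /subnK <-; elim: (k - j)%N => // d IH; rewrite addSn => /CkS; exact: IH.
Qed.

Lemma derivable_rV (V : normedModType R) n (P : V -> 'rV[R]_n) y v :
  (forall a, derivable (fun z => P z 0 a) y v) -> derivable P y v.
Proof. by move=> dP; apply/derivable_mxP => i a; rewrite ord1. Qed.

Section Fixed.
Variables (m : nat) (U : set 'rV[R]_m).
Hypothesis oU : open U.
Implicit Types F G : 'rV[R]_m -> R.

Lemma Ck_subset k (U' : set 'rV[R]_m) F : U' `<=` U -> Ck k U F -> Ck k U' F.
Proof.
move=> UU; elim: k F => [|k IH] F [cF dF].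
  by split=> // y /UU; exact: cF.
split=> [y /UU|i]; first exact: cF.
by have [dFi CFi] := dF i; split=> [y /UU|]; [exact: dFi|exact: IH].
Qed.

Lemma Ck_sum k (I : Type) (r : seq I) (P : pred I) (F : I -> 'rV[R]_m -> R) :
  (forall i, P i -> Ck k U (F i)) -> Ck k U (fun y => \sum_(i <- r | P i) F i y).
Proof.
move=> CF; elim: r => [|i r IH].
  by apply: eq_Ck (Ck_cst oU k 0) => // y _; rewrite big_nil.
have [Pi|nPi] := boolP (P i).
  apply: eq_Ck (CkD oU (CF i Pi) IH) => // y _.
  by rewrite big_cons Pi.
by apply: eq_Ck IH => // y _; rewrite big_cons (negPf nPi).
Qed.

Lemma Ck_prod k (I : Type) (r : seq I) (P : pred I) (F : I -> 'rV[R]_m -> R) :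
  (forall i, P i -> Ck k U (F i)) -> Ck k U (fun y => \prod_(i <- r | P i) F i y).
Proof.
move=> CF; elim: r => [|i r IH].
  by apply: eq_Ck (Ck_cst oU k 1) => // y _; rewrite big_nil.
have [Pi|nPi] := boolP (P i).
  apply: eq_Ck (CkM oU (CF i Pi) IH) => // y _.
  by rewrite big_cons Pi.
by apply: eq_Ck IH => // y _; rewrite big_cons (negPf nPi).
Qed.

(** Induction on k with [F] varying: a partial of the composite is a sum of products of
    [partial a F \o P], covered by the induction hypothesis, with partials of the coordinates of
    [P]. *)
Lemma Ck_comp k n (V : set 'rV[R]_n) (F : 'rV[R]_n -> R)
    (P : 'rV[R]_m -> 'rV[R]_n) :
  open V -> (forall y, U y -> V (P y)) ->
  (forall a, Ck k U (fun y => P y 0 a)) -> Ck k V F ->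
  Ck k U (F \o P).
Proof.
move=> oV UV; elim: k F => [|k IH] F CP CF.
  split=> // y Uy; apply: continuous_comp; last by apply: CF.1; exact: UV.
  by apply: continuous_rV => a; exact: (CP a).1.
split=> [y Uy|i].
  apply: continuous_comp; last by apply: CF.1; exact: UV.
  by apply: continuous_rV => a; exact: (CP a).1.
have dcomp y : U y -> _ := fun Uy =>
  is_derive_comp (Ck1_differentiable oV (UV y Uy) (Ck_le (ltn0Sn k) CF))
    (derivable_rV (fun a => ((CP a).2 i).1 y Uy)).
split=> [y /dcomp [] //|].
have CS : Ck k U (fun y => \sum_a partial a F (P y) *
    partial i (fun z => P z 0 a) y).
  apply: Ck_sum => a _; apply: CkM => //; last exact: ((CP a).2 i).2.
  by apply: IH; [move=> b; exact: CkS (CP b)|exact: (CF.2 a).2].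
by apply: eq_Ck CS => // y /dcomp [_ <-].
Qed.

Lemma Ck_inv k F : (forall y, U y -> F y != 0) -> Ck k U F ->
  Ck k U (fun y => (F y)^-1).
Proof.
move=> F0; elim: k => [|k IH] CF.
  by split=> // y Uy; exact: (cvgV (F0 y Uy) (CF.1 y Uy)).
split=> [y Uy|i]; first exact: (cvgV (F0 y Uy) (CF.1 y Uy)).
have [dFi CFi] := CF.2 i; split=> [y Uy|].
  exact: (derivableV (F0 y Uy) (dFi y Uy)).
have C2 := IH (CkS CF).
have := CkM oU (CkM oU (Ck_cst oU k (-1)) (CkM oU C2 C2)) CFi.
apply: eq_Ck => // y Uy.
rewrite [RHS]deriveV; [|exact: F0|exact: dFi].
by rewrite mulN1r /partial expr2 invfM.
Qed.

Lemma Ck_det k n (A : 'rV[R]_m -> 'M[R]_n) :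
  (forall i j, Ck k U (fun y => A y i j)) -> Ck k U (fun y => \det (A y)).
Proof.
move=> CA; apply: Ck_sum => s _; apply: CkM => //; first exact: Ck_cst.
by apply: Ck_prod => i _; exact: CA.
Qed.

(** Cramer's rule: the entries are cofactors divided by the determinant. *)
Lemma Ck_invmx k n (A : 'rV[R]_m -> 'M[R]_n) :
  (forall y, U y -> A y \in unitmx) ->
  (forall i j, Ck k U (fun y => A y i j)) ->
  forall i j, Ck k U (fun y => invmx (A y) i j).
Proof.
move=> uA CA i j.
have : Ck k U (fun y => (\det (A y))^-1 * cofactor (A y) j i).
  apply: CkM => //; first apply: Ck_inv.
  - by move=> y /uA; rewrite unitmxE unitfE.
  - exact: Ck_det.
  apply: CkM => //; first exact: Ck_cst.
  apply: Ck_det => a b.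
  by apply: eq_Ck (CA (lift j a) (lift i b)) => // y _; rewrite !mxE.
by apply: eq_Ck => // y Uy; rewrite /invmx uA// !mxE.
Qed.

End Fixed.
End Smooth.

(** * Smooth fields and frames *)

Section SmoothFields.
Variables (R : realType) (m : nat) (U : set 'rV[R]_m).
Hypothesis oU : open U.
Implicit Types F G : 'rV[R]_m -> R.

Definition smooth_field n (X : 'rV[R]_m -> 'rV[R]_n) :=
  forall a, smooth_on U (fun y => X y 0 a).

Lemma eq_smooth_on F G :
  (forall y, U y -> F y = G y) -> smooth_on U F -> smooth_on U G.
Proof. by move=> FG sF k; apply: eq_Ck FG (sF k). Qed.

Lemma smooth_on_cst (c : R) : smooth_on U (fun=> c).
Proof. by move=> k; exact: Ck_cst. Qed.

Lemma smooth_on_subset (U' : set 'rV[R]_m) F :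
  U' `<=` U -> smooth_on U F -> smooth_on U' F.
Proof. by move=> UU sF j; apply: Ck_subset UU (sF j). Qed.

Lemma smooth_onD F G :
  smooth_on U F -> smooth_on U G -> smooth_on U (fun y => F y + G y).
Proof. by move=> sF sG k; exact: CkD. Qed.

Lemma smooth_onM F G :
  smooth_on U F -> smooth_on U G -> smooth_on U (fun y => F y * G y).
Proof. by move=> sF sG k; exact: CkM. Qed.

Lemma smooth_onB F G :
  smooth_on U F -> smooth_on U G -> smooth_on U (fun y => F y - G y).
Proof.
move=> sF sG; have := smooth_onD sF (smooth_onM (smooth_on_cst (-1)) sG).
by apply: eq_smooth_on => y _; rewrite mulN1r.
Qed.

Lemma smooth_on_sum (I : Type) (r : seq I) (P : pred I)
    (F : I -> 'rV[R]_m -> R) :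
  (forall i, smooth_on U (F i)) ->
  smooth_on U (fun y => \sum_(i <- r | P i) F i y).
Proof. by move=> sF k; apply: Ck_sum => // i _; exact: sF. Qed.

Lemma smooth_on_derivable F i y :
  smooth_on U F -> U y -> derivable F y (bvec R i).
Proof. by move=> /(_ 1)[_ dF]; exact: (dF i).1. Qed.

Lemma smooth_on_partial F i : smooth_on U F -> smooth_on U (partial i F).
Proof. by move=> sF k; exact: ((sF k.+1).2 i).2. Qed.

Lemma partialD F G i y : smooth_on U F -> smooth_on U G -> U y ->
  partial i (fun z => F z + G z) y = partial i F y + partial i G y.
Proof. by move=> sF sG Uy; apply: deriveD; exact: smooth_on_derivable. Qed.

Lemma partialM F G i y : smooth_on U F -> smooth_on U G -> U y ->
  partial i (fun z => F z * G z) y = F y * partial i G y + G y * partial i F y.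
Proof. by move=> sF sG Uy; apply: deriveM; exact: smooth_on_derivable. Qed.

Lemma partial_cst (W : normedModType R) (c : W) i y :
  partial i (fun _ : 'rV[R]_m => c) y = 0.
Proof. exact: derive_cst. Qed.

Lemma partial_sum (I : finType) (F : I -> 'rV[R]_m -> R) i y :
  (forall j, smooth_on U (F j)) -> U y ->
  partial i (fun z => \sum_j F j z) y = \sum_j partial i (F j) y.
Proof.
move=> sF Uy; rewrite -big_enum/=.
under eq_fun do rewrite -big_enum/=.
elim: (enum I) => [|j r IH].
  under eq_fun do rewrite big_nil.
  by rewrite big_nil partial_cst.
under eq_fun do rewrite big_cons.
by rewrite partialD ?IH ?big_cons//; exact: smooth_on_sum.
Qed.

Lemma eq_partial (W : normedModType R) (F G : 'rV[R]_m -> W) i y :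
  (forall z, U z -> F z = G z) -> U y -> partial i F y = partial i G y.
Proof.
move=> FG Uy; apply: near_eq_derive.
by apply: filterS (open_nbhs_nbhs (conj oU Uy)).
Qed.

Section Field.
Variable n : nat.
Implicit Types X Y : 'rV[R]_m -> 'rV[R]_n.

Lemma smooth_field_derivable X i y :
  smooth_field X -> U y -> derivable X y (bvec R i).
Proof.
by move=> sX Uy; apply: derivable_rV => a; exact: smooth_on_derivable.
Qed.

Lemma partial_coord X i y a : smooth_field X -> U y ->
  partial i X y 0 a = partial i (fun z => X z 0 a) y.
Proof.
by move=> sX Uy; rewrite /partial (derive_mx (smooth_field_derivable sX Uy)) mxE.
Qed.

Lemma eq_smooth_field X Y :
  (forall y, U y -> X y = Y y) -> smooth_field X -> smooth_field Y.
Proof. by move=> XY sX a; apply: eq_smooth_on (sX a) => y /XY ->. Qed.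

Lemma smooth_field_partial X i : smooth_field X -> smooth_field (partial i X).
Proof.
move=> sX a; apply: eq_smooth_on (smooth_on_partial i (sX a)) => y Uy.
by rewrite partial_coord.
Qed.

Lemma smooth_fieldD X Y :
  smooth_field X -> smooth_field Y -> smooth_field (fun y => X y + Y y).
Proof.
by move=> sX sY a; apply: eq_smooth_on (smooth_onD (sX a) (sY a)) => y _; rewrite mxE.
Qed.

Lemma smooth_fieldB X Y :
  smooth_field X -> smooth_field Y -> smooth_field (fun y => X y - Y y).
Proof.
by move=> sX sY a; apply: eq_smooth_on (smooth_onB (sX a) (sY a)) => y _; rewrite !mxE.
Qed.

Lemma smooth_fieldZ F X :
  smooth_on U F -> smooth_field X -> smooth_field (fun y => F y *: X y).
Proof.
by move=> sF sX a; apply: eq_smooth_on (smooth_onM sF (sX a)) => y _; rewrite mxE.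
Qed.

Lemma smooth_field_sum (I : finType) (X : I -> 'rV[R]_m -> 'rV[R]_n) :
  (forall i, smooth_field (X i)) -> smooth_field (fun y => \sum_i X i y).
Proof.
move=> sX a; have sXa i : smooth_on U (fun y => X i y 0 a) by exact: sX.
by apply: eq_smooth_on (smooth_on_sum _ _ sXa) => y _; rewrite summxE.
Qed.

Lemma partial_fieldD X Y i y : smooth_field X -> smooth_field Y -> U y ->
  partial i (fun z => X z + Y z) y = partial i X y + partial i Y y.
Proof.
by move=> sX sY Uy; apply: deriveD; exact: smooth_field_derivable.
Qed.

Lemma partial_fieldZ F X i y : smooth_on U F -> smooth_field X -> U y ->
  partial i (fun z => F z *: X z) y = F y *: partial i X y + partial i F y *: X y.
Proof.
move=> sF sX Uy; apply/rowP => a.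
rewrite partial_coord//; last exact: smooth_fieldZ.
rewrite !mxE partial_coord// [partial i F y * _]mulrC -partialM//.
by congr (partial i _ y); apply/funext => z; rewrite mxE.
Qed.

End Field.

End SmoothFields.

(** * Linearity of derivatives, Christoffel forms and metric traces *)

Section Frames.
Variables (R : realType) (k : nat).
Implicit Type (y : 'rV[R]_k).

Lemma along_cframe (W : normedModType R) (F : 'rV[R]_k -> W) i :
  along (cframe i) F = partial i F.
Proof.
apply/funext => y; rewrite /along (bigD1 i)//= big1 ?addr0 => [|j ji].
  by rewrite mxE !eqxx scale1r.
by rewrite mxE (negPf ji) scale0r.
Qed.

Lemma along_cst (W : normedModType R) V (c : W) y : along V (fun=> c) y = 0.
Proof. by rewrite /along big1// => i _; rewrite partial_cst scaler0. Qed.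

Lemma alongZ (W : normedModType R) (F : 'rV[R]_k -> W) (a : R) v y :
  along (fun=> a *: v) F y = a *: along (fun=> v) F y.
Proof.
rewrite /along scaler_sumr; apply: eq_bigr => i _.
by rewrite mxE scalerA.
Qed.

Lemma alongB (W : normedModType R) (F : 'rV[R]_k -> W) u v y :
  along (fun=> u - v) F y = along (fun=> u) F y - along (fun=> v) F y.
Proof.
rewrite /along -sumrB; apply: eq_bigr => i _.
by rewrite !mxE scalerBl.
Qed.

Variable G : 'rV[R]_k -> 'M[R]_k.

Lemma chr_formDr y u v w : chr_form G y u (v + w) = chr_form G y u v + chr_form G y u w.
Proof.
apply/rowP => l; rewrite !mxE -big_split/=; apply: eq_bigr => i _.
by rewrite -big_split; apply: eq_bigr => j _; rewrite mxE mulrDr.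
Qed.

Lemma chr_formZr y u v (a : R) : chr_form G y u (a *: v) = a *: chr_form G y u v.
Proof.
apply/rowP => l; rewrite !mxE mulr_sumr; apply: eq_bigr => i _.
by rewrite mulr_sumr; apply: eq_bigr => j _; rewrite mxE mulrCA.
Qed.

Lemma chr_formDl y u v w : chr_form G y (u + v) w = chr_form G y u w + chr_form G y v w.
Proof.
apply/rowP => l; rewrite !mxE -big_split/=; apply: eq_bigr => i _.
by rewrite -big_split; apply: eq_bigr => j _; rewrite mxE mulrDr mulrDl.
Qed.

Lemma chr_formZl y u v (a : R) : chr_form G y (a *: u) v = a *: chr_form G y u v.
Proof.
apply/rowP => l; rewrite !mxE mulr_sumr; apply: eq_bigr => i _.
by rewrite mulr_sumr; apply: eq_bigr => j _; rewrite mxE mulrCA -!mulrA.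
Qed.

Lemma chr_form0l y v : chr_form G y 0 v = 0.
Proof. by have := chr_formZl y 0 v 0; rewrite !scale0r. Qed.

Lemma chr_form_suml (I : finType) y (u : I -> 'rV[R]_k) v :
  chr_form G y (\sum_i u i) v = \sum_i chr_form G y (u i) v.
Proof. 
exact: (big_morph (fun u => chr_form G y u v)
  (fun u w => chr_formDl y u w v) (chr_form0l y v)).
Qed.

Lemma chr_form_cframe i j y :
  chr_form G y (bvec R i) (bvec R j) = \row_l christoffel G y l i j.
Proof.
apply/rowP => l; rewrite !mxE (bigD1 i)//= [X in _ + X]big1 => [|a ai].
  rewrite addr0 (bigD1 j)//= big1 => [|b bj]; rewrite !mxE !eqxx ?mulr1 ?addr0//.
  by rewrite (negPf bj) mulr0.
by rewrite big1// => b _; rewrite !mxE (negPf ai) mulr0 mul0r.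
Qed.

Lemma nabla_cframe i j y :
  nabla G (cframe i) (cframe j) y = \row_l christoffel G y l i j.
Proof. by rewrite /nabla along_cst add0r chr_form_cframe. Qed.

Lemma trace_gD (W : normedModType R) (B C : 'I_k -> 'I_k -> W) y :
  trace_g G (fun i j => B i j + C i j) y = trace_g G B y + trace_g G C y.
Proof.
rewrite -big_split/=; apply: eq_bigr => i _; rewrite -big_split.
by apply: eq_bigr => j _; rewrite scalerDr.
Qed.

Lemma trace_gN (W : normedModType R) (B : 'I_k -> 'I_k -> W) y :
  trace_g G (fun i j => - B i j) y = - trace_g G B y.
Proof.
rewrite -sumrN; apply: eq_bigr => i _; rewrite -sumrN.
by apply: eq_bigr => j _; rewrite scalerN.
Qed.

Lemma trace_gZ (W : normedModType R) (B : 'I_k -> 'I_k -> W) y (a : R) :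
  trace_g G (fun i j => a *: B i j) y = a *: trace_g G B y.
Proof.
rewrite scaler_sumr; apply: eq_bigr => i _; rewrite scaler_sumr.
by apply: eq_bigr => j _; rewrite !scalerA mulrC.
Qed.

Lemma eq_trace_g (W : normedModType R) (B C : 'I_k -> 'I_k -> W) y :
  (forall i j, B i j = C i j) -> trace_g G B y = trace_g G C y.
Proof. by move=> BC; do 2 (apply: eq_bigr => ? _); rewrite BC. Qed.

Lemma trace_gZl (W : normedModType R) (B : 'I_k -> 'I_k -> R) (w : W) y :
  trace_g G (fun i j => B i j *: w) y = trace_g G B y *: w.
Proof.
rewrite scaler_suml; apply: eq_bigr => i _; rewrite scaler_suml.
by apply: eq_bigr => j _; rewrite scalerA.
Qed.

(** Up to sign, the l-th component is the Laplacian of the l-th coordinate function. It is not a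
    tensor, but within one chart it carries the whole contribution of the Levi-Civita connection of
    the domain to traced second-order operators. *)
Definition chr_trace y : 'rV[R]_k :=
  \row_l \sum_i \sum_j invmx (G y) i j * christoffel G y l i j.

Lemma trace_along (W : normedModType R) (F : 'rV[R]_k -> W) y :
  trace_g G (fun i j => along (nabla G (cframe i) (cframe j)) F y) y =
  along chr_trace F y.
Proof.
rewrite /trace_g /along.
under eq_bigr do under eq_bigr do rewrite scaler_sumr.
under eq_bigr do rewrite exchange_big/=.
rewrite exchange_big/=; apply: eq_bigr => l _; rewrite mxE scaler_suml.
apply: eq_bigr => i _; rewrite scaler_suml; apply: eq_bigr => j _.
by rewrite nabla_cframe mxE scalerA.
Qed.

End Frames.

(** * The Laplacian in coordinates *)

Section ChristoffelAlgebra.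
Variables (R : realType) (k : nat).
Variables (g : 'I_k -> 'I_k -> R) (D : 'I_k -> 'I_k -> 'I_k -> R).
Hypothesis g_sym : forall i j, g i j = g j i.
Hypothesis D_sym : forall s i j, D s i j = D s j i.

(** Index algebra at a single point: [g] is to be the inverse metric and [D s i j] the s-th partial
    of the (i, j) entry of the metric. Both contractions needed for the Laplacian are combinations
    of [S1] and [S2]. *)
Let chr l i j := 2^-1 * \sum_s g l s * (D i j s + D j i s - D s i j).
Let S1 l := \sum_i \sum_j \sum_s g i j * g l s * D i j s.
Let S2 l := \sum_i \sum_j \sum_s g i j * g l s * D s i j.

(** The first two terms of the Christoffel symbol contract to the same sum by symmetry of [g], which
    cancels the factor 1/2 in front of [S1]. *)
Lemma christoffel_traceE l :
  \sum_i \sum_j g i j * chr l i j = S1 l - 2^-1 * S2 l.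
Proof.
have -> : S1 l = 2^-1 * (S1 l + \sum_i \sum_j \sum_s g i j * g l s * D j i s).
  have -> : \sum_i \sum_j \sum_s g i j * g l s * D j i s = S1 l.
    rewrite exchange_big/=; apply: eq_bigr => i _; apply: eq_bigr => j _.
    by apply: eq_bigr => s _; rewrite g_sym.
  by field.
rewrite -mulrBr -big_split/= /S2 -sumrB mulr_sumr; apply: eq_bigr => i _.
rewrite -big_split/= -sumrB mulr_sumr; apply: eq_bigr => j _.
rewrite -big_split/= -sumrB mulrCA mulr_sumr; congr (_ * _).
by apply: eq_bigr => s _; ring.
Qed.

(** In Gamma^i_ij the first and third terms cancel by symmetry; what survives is 1/2 g^is d_j g_is,
    the logarithmic derivative of the volume density. *)
Lemma christoffel_contractE l :
  \sum_i \sum_j chr i i j * g j l = 2^-1 * S2 l.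
Proof.
have H j : \sum_i chr i i j = 2^-1 * \sum_i \sum_s g i s * D j i s.
  rewrite -mulr_sumr; congr (_ * _).
  have -> : \sum_i \sum_s g i s * (D i j s + D j i s - D s i j) =
     \sum_i \sum_s g i s * D j i s +
     (\sum_i \sum_s g i s * D i j s - \sum_i \sum_s g i s * D s i j).
    rewrite -sumrB -big_split/=; apply: eq_bigr => i _.
    by rewrite -sumrB -big_split/=; apply: eq_bigr => s _; ring.
  rewrite [X in X - _]exchange_big/= [X in _ + (X - _)](_ : _ =
    \sum_i \sum_s g i s * D s i j) ?subrr ?addr0//.
  by apply: eq_bigr => i _; apply: eq_bigr => s _; rewrite g_sym D_sym.
rewrite exchange_big/=; under eq_bigr do rewrite -mulr_suml H -mulrA.
rewrite -mulr_sumr; congr (_ * _); rewrite /S2.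
under eq_bigr do rewrite mulr_suml.
rewrite exchange_big/=; apply: eq_bigr => i _.
under eq_bigr do rewrite mulr_suml.
rewrite exchange_big/=; apply: eq_bigr => j _.
by apply: eq_bigr => s _; rewrite (g_sym s l); ring.
Qed.

End ChristoffelAlgebra.

Record smooth_metric (R : realType) k (U : set 'rV[R]_k)
    (G : 'rV[R]_k -> 'M[R]_k) : Prop := SmoothMetric {
  sm_smooth : forall i j, smooth_on U (fun y => G y i j);
  sm_unit : forall y, U y -> G y \in unitmx;
  sm_sym : forall y, U y -> (G y)^T = G y }.

Section Metric.
Variables (R : realType) (k : nat) (U : set 'rV[R]_k).
Hypothesis oU : open U.
Variable G : 'rV[R]_k -> 'M[R]_k.
Hypothesis sG : smooth_metric U G.

Lemma smooth_invmx i j : smooth_on U (fun y => invmx (G y) i j).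
Proof.
move=> n; apply: Ck_invmx => // [y|a b]; first exact: (sm_unit sG).
exact: (sm_smooth sG).
Qed.

Lemma smooth_christoffel l i j : smooth_on U (fun y => christoffel G y l i j).
Proof.
apply: (smooth_onM oU); first exact: smooth_on_cst.
apply: (smooth_on_sum oU) => s; apply: (smooth_onM oU); first exact: smooth_invmx.
by apply: smooth_onB; rewrite //; first apply: smooth_onD;
  rewrite //; apply: smooth_on_partial; exact: (sm_smooth sG).
Qed.

Lemma invmx_sym y i j : U y -> invmx (G y) i j = invmx (G y) j i.
Proof. by move=> Uy; rewrite -{1}(sm_sym sG Uy) -trmx_inv mxE. Qed.

Lemma gram_symE y i j : U y -> G y i j = G y j i.
Proof. by move=> Uy; rewrite -{1}(sm_sym sG Uy) mxE. Qed.

Lemma partial_gram_sym y s i j : U y ->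
  partial s (fun z => G z i j) y = partial s (fun z => G z j i) y.
Proof. by move=> Uy; apply: (eq_partial oU) => // z Uz; exact: gram_symE. Qed.

Lemma smooth_grad F : smooth_on U F -> smooth_field U (grad G F).
Proof.
move=> sF a; apply: (@eq_smooth_on _ _ _ oU
  (fun y => \sum_j invmx (G y) a j * partial j F y)).
  by move=> y _; rewrite mxE.
apply: (smooth_on_sum oU) => j; apply: (smooth_onM oU); first exact: smooth_invmx.
exact: smooth_on_partial.
Qed.

(** Differentiate the constant product of the inverse with [G], then multiply on the right by the
    inverse. *)
Lemma partial_invmx y s i j : U y ->
  partial s (fun z => invmx (G z) i j) y =
  - \sum_a \sum_b invmx (G y) i a * partial s (fun z => G z a b) y *
                  invmx (G y) b j.
Proof.
move=> Uy.
pose dg : 'M[R]_k := \matrix_(i, j) partial s (fun z => invmx (G z) i j) y.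
pose D : 'M[R]_k := \matrix_(i, j) partial s (fun z => G z i j) y.
have E : dg *m G y + invmx (G y) *m D = 0.
  apply/matrixP => a b; rewrite !mxE -big_split/=.
  transitivity (partial s (fun z => \sum_c invmx (G z) a c * G z c b) y).
    rewrite (partial_sum oU)// => [|c]; last first.
      by apply: smooth_onM => //; [exact: smooth_invmx|exact: (sm_smooth sG)].
    apply: eq_bigr => c _; rewrite !mxE (partialM _ (smooth_invmx _ _))//.
      by rewrite addrC; congr (_ + _); rewrite mulrC.
    exact: (sm_smooth sG).
  rewrite -[RHS](partial_cst ((1%:M : 'M[R]_k) a b) s y).
  apply: (eq_partial oU) => // z Uz.
  by rewrite -(mulVmx (sm_unit sG Uz)) mxE.
have -> : partial s (fun z => invmx (G z) i j) y = dg i j by rewrite mxE.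
have -> : dg = - (invmx (G y) *m D *m invmx (G y)).
  rewrite -[dg]mulmx1 -(mulmxV (sm_unit sG Uy)) mulmxA.
  by move/eqP: E; rewrite addr_eq0 => /eqP ->; rewrite mulNmx.
rewrite !mxE exchange_big/=; congr (- _); apply: eq_bigr => b _.
by rewrite !mxE mulr_suml; apply: eq_bigr => a _; rewrite mxE.
Qed.

(** Beside the second derivatives of F, the divergence of the gradient contains the derivative of
    the inverse metric, contributing - S1, and the contraction Gamma^i_ij, contributing S2 / 2.
    Together these are - [chr_trace]. *)
Lemma laplacianE F y : smooth_on U F -> U y ->
  laplacian G F y =
  trace_g G (fun i j => partial i (partial j F) y) y - along (chr_trace G) F y.
Proof.
move=> sF Uy; rewrite /laplacian /divergence.
have E1 i : nabla G (cframe i) (grad G F) y 0 i =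
    \sum_j (invmx (G y) i j * partial i (partial j F) y +
            partial j F y * partial i (fun z => invmx (G z) i j) y) +
    \sum_j christoffel G y i i j * grad G F y 0 j.
  rewrite /nabla along_cframe mxE (partial_coord _ _ (smooth_grad sF) Uy).
  congr (_ + _).
    have -> : (fun z => grad G F z 0 i) =
        (fun z => \sum_j invmx (G z) i j * partial j F z).
      by apply/funext => z; rewrite mxE.
    rewrite (partial_sum oU)// => [|j]; last first.
      apply: smooth_onM => //; first exact: smooth_invmx.
      exact: smooth_on_partial.
    apply: eq_bigr => j _; rewrite (partialM _ (smooth_invmx _ _))//.
    exact: smooth_on_partial.
  rewrite mxE (bigD1 i)//= [X in _ + X]big1 ?addr0 => [|a ai].
    by apply: eq_bigr => j _; rewrite mxE !eqxx mulr1.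
  by rewrite big1// => j _; rewrite mxE (negPf ai) mulr0 mul0r.
under eq_bigr do rewrite E1 big_split/= -addrA.
rewrite big_split/=; congr (_ + _).
pose g i j := invmx (G y) i j.
pose D s i j := partial s (fun z => G z i j) y.
have gs i j : g i j = g j i by exact: invmx_sym.
have Ds s i j : D s i j = D s j i by exact: partial_gram_sym.
rewrite big_split/= [X in X + _](_ : _ =
   \sum_l - (\sum_i \sum_j \sum_s g i j * g l s * D i j s) * partial l F y).
  rewrite [X in _ + X](_ : _ =
    \sum_l (\sum_i \sum_j christoffel G y i i j * g j l) * partial l F y).
    rewrite -big_split -sumrN/=; apply: eq_bigr => l _.
    have -> : \sum_i \sum_j christoffel G y i i j * g j l = _ :=
      christoffel_contractE gs Ds l.
    have -> : chr_trace G y 0 l = _ := etrans (mxE _ _ _ _) (christoffel_traceE D gs l).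
    by rewrite -mulrDl -scaleNr opprB [in RHS]addrC.
  under [RHS]eq_bigr do rewrite mulr_suml.
  rewrite [RHS]exchange_big/=; apply: eq_bigr => i _.
  under [RHS]eq_bigr do rewrite mulr_suml.
  rewrite [RHS]exchange_big/=; apply: eq_bigr => j _.
  by rewrite mxE mulr_sumr; apply: eq_bigr => l _; rewrite mulrA.
rewrite exchange_big/=; apply: eq_bigr => l _.
rewrite -mulr_sumr mulrC -sumrN; congr (_ * _); apply: eq_bigr => i _.
rewrite partial_invmx//; congr (- _).
do 2 apply: eq_bigr => ? _; rewrite -/(g _ _) -/(g _ l) (gs _ l) /D/=; ring.
Qed.

End Metric.

(** * Conformal change and the Jacobi operator *)

Section ConformalChange.
Variables (R : realType) (k : nat) (U : set 'rV[R]_k).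
Hypothesis oU : open U.
Variable G : 'rV[R]_k -> 'M[R]_k.
Hypothesis sG : smooth_metric U G.
Variable L : 'rV[R]_k -> R.
Hypothesis sL : smooth_on U L.
Hypothesis L_neq0 : forall y, U y -> L y != 0.

Let Gb y := L y *: G y.

Lemma smooth_metric_conformal : smooth_metric U Gb.
Proof.
split=> [i j|y Uy|y Uy].
- apply: eq_smooth_on (smooth_onM oU sL (sm_smooth sG i j)) => // y _.
  by rewrite mxE.
- by rewrite unitmxZ ?unitfE ?L_neq0// (sm_unit sG).
- by rewrite linearZ/= (sm_sym sG).
Qed.

Lemma invmx_conformal y : U y -> invmx (Gb y) = (L y)^-1 *: invmx (G y).
Proof. by move=> Uy; rewrite invmxZ// (sm_unit smooth_metric_conformal). Qed.

Lemma trace_conformal (W : normedModType R) (B : 'I_k -> 'I_k -> W) y : U y ->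
  trace_g Gb B y = (L y)^-1 *: trace_g G B y.
Proof.
move=> Uy; rewrite /trace_g scaler_sumr; apply: eq_bigr => i _.
rewrite scaler_sumr; apply: eq_bigr => j _.
by rewrite invmx_conformal// mxE scalerA.
Qed.

Lemma invmx_mulG y i j : U y ->
  \sum_s invmx (G y) i s * G y j s = (i == j)%:R.
Proof.
move=> Uy; transitivity ((invmx (G y) *m G y) i j).
  by rewrite mxE; apply: eq_bigr => s _; rewrite (gram_symE sG).
by rewrite mulVmx ?mxE// (sm_unit sG).
Qed.

(** By the product rule, the terms with derivatives of G reproduce the old symbol, as L cancels
    against the inverse metric; in the terms with derivatives of L, the inverse metric meets G and
    leaves Kronecker deltas. *)
Lemma christoffel_conformal y l i j : U y ->
  christoffel Gb y l i j = christoffel G y l i j +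
    2^-1 * (L y)^-1 * ((l == j)%:R * partial i L y + (l == i)%:R * partial j L y
                       - G y i j * grad G L y 0 l).
Proof.
move=> Uy; rewrite -mulrA /christoffel -mulrDr; congr (_ * _).
have dG s a b : partial s (fun z => Gb z a b) y =
    L y * partial s (fun z => G z a b) y + G y a b * partial s L y.
  rewrite -(partialM _ sL (sm_smooth sG a b) Uy).
  by congr (partial s _ y); apply/funext => z; rewrite mxE.
(* The deltas are expanded back into contractions, so that both sides are sums over s that agree
   term by term. *)
rewrite -!(invmx_mulG _ _ Uy) mxE !mulr_suml mulr_sumr -big_split/=.
rewrite -sumrB mulr_sumr -big_split/=; apply: eq_bigr => s _.
rewrite invmx_conformal// !mxE !dG.
move: (partial i _ y) (partial j _ y) (partial s _ y) => Gi Gj Gs.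
move: (partial i _ y) (partial j _ y) (partial s _ y) => Li Lj Ls.
move: (invmx _ l s) (G y j s) (G y i s) (G y i j) => gl gjs gis gij.
by field; exact: L_neq0.
Qed.

(** Tracing the correction, each delta term yields grad L once, and the last term yields it k times
    with a minus sign since [invmx G] traces [G] to k; hence the factor 2 - k. *)
Lemma chr_trace_conformal y : U y ->
  chr_trace Gb y = (L y)^-1 *:
    (chr_trace G y + ((2 - k%:R) / 2 / L y) *: grad G L y).
Proof.
move=> Uy; apply/rowP => l; rewrite !mxE.
have E : \sum_i \sum_j invmx (G y) i j *
   ((l == j)%:R * partial i L y + (l == i)%:R * partial j L y
    - G y i j * grad G L y 0 l) = (2 - k%:R) * grad G L y 0 l.
  have E1 : \sum_i \sum_j invmx (G y) i j * ((l == j)%:R * partial i L y) =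
      grad G L y 0 l.
    rewrite mxE; apply: eq_bigr => i _; rewrite (bigD1 l)//= big1 => [|j jl].
      by rewrite eqxx mul1r addr0 (invmx_sym sG).
    by rewrite eq_sym (negPf jl) mul0r mulr0.
  have E2 : \sum_i \sum_j invmx (G y) i j * ((l == i)%:R * partial j L y) =
      grad G L y 0 l.
    rewrite mxE (bigD1 l)//= [X in _ + X]big1 ?addr0 => [|i il].
      by apply: eq_bigr => j _; rewrite eqxx mul1r.
    by rewrite big1// => j _; rewrite eq_sym (negPf il) mul0r mulr0.
  have E3 : \sum_i \sum_j invmx (G y) i j * G y i j = k%:R.
    under eq_bigr do rewrite (invmx_mulG _ _ Uy) eqxx.
    by rewrite sumr_const card_ord.
  have -> : (2 - k%:R) * grad G L y 0 l =
     grad G L y 0 l + grad G L y 0 l - k%:R * grad G L y 0 l by ring.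
  rewrite -[X in _ = X + _ - _]E1 -[X in _ = _ + X - _]E2 -E3 mulr_suml.
  rewrite -big_split -sumrB/=; apply: eq_bigr => i _.
  rewrite mulr_suml -big_split -sumrB/=; apply: eq_bigr => j _; ring.
have -> : \sum_j invmx (G y) l j * partial j L y = grad G L y 0 l by rewrite mxE.
have -> : (2 - k%:R) / 2 / L y * grad G L y 0 l =
   2^-1 * (L y)^-1 * ((2 - k%:R) * grad G L y 0 l) by ring.
rewrite -E !mulr_sumr -big_split/= mulr_sumr; apply: eq_bigr => i _.
rewrite mulr_sumr -big_split/= mulr_sumr; apply: eq_bigr => j _.
rewrite invmx_conformal// christoffel_conformal// mxE; ring.
Qed.

End ConformalChange.

(** * Connection, tension field and Jacobi operator along a map *)

Section AlongMap.
Variables (R : realType) (m n : nat) (U : set 'rV[R]_m) (V : set 'rV[R]_n).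
Hypotheses (oU : open U) (oV : open V).
Variable H : 'rV[R]_n -> 'M[R]_n.
Hypothesis sH : smooth_metric V H.
Variable Phi : 'rV[R]_m -> 'rV[R]_n.
Hypotheses (sPhi : smooth_field U Phi) (PhiV : forall y, U y -> V (Phi y)).
Implicit Types X Y : 'rV[R]_m -> 'rV[R]_n.

Lemma pnablaE W X y : pnabla H Phi W X y =
  \sum_j W y 0 j *: pnabla H Phi (cframe j) X y.
Proof.
rewrite /pnabla {2}/along chr_form_suml /along -big_split/=; apply: eq_bigr => j _.
by rewrite chr_formZl -scalerDr -!/(along _ _ _) !along_cframe.
Qed.

Lemma pnabla_value W W' X y : W y = W' y -> pnabla H Phi W X y = pnabla H Phi W' X y.
Proof. by move=> WW; rewrite pnablaE [RHS]pnablaE WW. Qed.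

Lemma pnablaZl (a : R) v X y :
  pnabla H Phi (fun=> a *: v) X y = a *: pnabla H Phi (fun=> v) X y.
Proof.
rewrite pnablaE [in RHS]pnablaE scaler_sumr; apply: eq_bigr => j _.
by rewrite mxE scalerA.
Qed.

Lemma pnablaBl u v X y :
  pnabla H Phi (fun=> u - v) X y =
  pnabla H Phi (fun=> u) X y - pnabla H Phi (fun=> v) X y.
Proof.
rewrite !(pnablaE (fun=> _)) -sumrB; apply: eq_bigr => j _.
by rewrite !mxE scalerBl.
Qed.

Lemma eq_pnabla W X Y y : (forall z, U z -> X z = Y z) -> U y ->
  pnabla H Phi W X y = pnabla H Phi W Y y.
Proof.
move=> XY Uy.
have E : along W X y = along W Y y.
  apply: eq_bigr => i _.
  by rewrite (eq_partial oU i XY Uy).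
by rewrite /pnabla E (XY y Uy).
Qed.

Lemma smooth_chr_form_Phi Y Z : smooth_field U Y -> smooth_field U Z ->
  smooth_field U (fun y => chr_form H (Phi y) (Y y) (Z y)).
Proof.
move=> sY sZ l; apply: (@eq_smooth_on _ _ _ oU (fun y => \sum_i \sum_j
  christoffel H (Phi y) l i j * Y y 0 i * Z y 0 j)).
  by move=> y _; rewrite mxE.
apply: (smooth_on_sum oU) => i.
apply: (smooth_on_sum oU) => j.
apply: (smooth_onM oU) => //; apply: (smooth_onM oU) => // c.
have sc := smooth_christoffel oV sH l i j.
by apply: (Ck_comp oU oV PhiV _ (sc c)) => a; exact: sPhi.
Qed.

Lemma smooth_pnabla_cframe i X : smooth_field U X ->
  smooth_field U (pnabla H Phi (cframe i) X).
Proof.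
move=> sX; rewrite /pnabla !along_cframe.
apply: (smooth_fieldD oU); first exact: smooth_field_partial.
by apply: smooth_chr_form_Phi => //; exact: smooth_field_partial.
Qed.

Lemma pnabla_cframeD i X Y y : smooth_field U X -> smooth_field U Y -> U y ->
  pnabla H Phi (cframe i) (fun z => X z + Y z) y =
  pnabla H Phi (cframe i) X y + pnabla H Phi (cframe i) Y y.
Proof.
move=> sX sY Uy; rewrite /pnabla chr_formDr !along_cframe.
by rewrite (partial_fieldD _ sX sY Uy) addrACA.
Qed.

Lemma pnabla_cframeZ i F X y : smooth_on U F -> smooth_field U X -> U y ->
  pnabla H Phi (cframe i) (fun z => F z *: X z) y =
  F y *: pnabla H Phi (cframe i) X y + partial i F y *: X y.
Proof.
move=> sF sX Uy; rewrite /pnabla chr_formZr !along_cframe.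
by rewrite (partial_fieldZ oU _ sF sX Uy) scalerDr addrAC.
Qed.

Lemma pnablaZr W F X y : smooth_on U F -> smooth_field U X -> U y ->
  pnabla H Phi W (fun z => F z *: X z) y =
  F y *: pnabla H Phi W X y + along W F y *: X y.
Proof.
move=> sF sX Uy; rewrite !(pnablaE W) scaler_sumr scaler_suml -big_split/=.
apply: eq_bigr => j _; rewrite pnabla_cframeZ// scalerDr.
by rewrite !scalerA mulrC.
Qed.

(** Stated for a number a: [curvature] takes vectors at a point, so a scalar function enters only
    through its value there. On constant extensions the bracket vanishes and [nabla] reduces to the
    Christoffel form, which is bilinear. *)
Lemma curvatureZ x (a : R) u v w : V x ->
  curvature H x u (a *: v) w = a *: curvature H x u v w.
Proof.
move=> Vx.
have nc (p q : 'rV[R]_n) : nabla H (fun=> p) (fun=> q) = fun z => chr_form H z p q.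
  by apply/funext => z; rewrite /nabla along_cst add0r.
have br (p q : 'rV[R]_n) : bracket (fun=> p) (fun=> q) = fun=> 0.
  by apply/funext => z; rewrite /bracket !along_cst subrr.
have chZ z p q : chr_form H z (a *: p) q = a *: chr_form H z p q by exact: chr_formZl.
have s0 (p q : 'rV[R]_n) : smooth_field V (fun z => chr_form H z p q).
  move=> l; apply: (@eq_smooth_on _ _ _ oV (fun y => \sum_i \sum_j
    christoffel H y l i j * p 0 i * q 0 j)).
    by move=> y _; rewrite mxE.
  do 2 apply: (smooth_on_sum oV) => ?.
  do 2 (apply: (smooth_onM oV); last exact: smooth_on_cst).
  exact: (smooth_christoffel oV sH).
rewrite /curvature/= !nc !br !nc/= !chr_form0l !subr0.
rewrite scalerBr; congr (_ - _).
  rewrite /nabla chZ chr_formZr scalerDr; congr (_ + _).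
  rewrite /along scaler_sumr; apply: eq_bigr => i _.
  have -> : (fun z => chr_form H z (a *: v) w) = (fun z => a *: chr_form H z v w).
    by apply/funext => z; rewrite chZ.
  have sa : smooth_on V (fun=> a) by exact: smooth_on_cst.
  rewrite (partial_fieldZ oV _ sa (s0 _ _) Vx) partial_cst scale0r addr0.
  by rewrite !scalerA mulrC.
by rewrite /nabla chr_formZl scalerDr alongZ.
Qed.

Section Metric.
Variable G : 'rV[R]_m -> 'M[R]_m.
Hypothesis sG : smooth_metric U G.

(** This trace, like the two after it, leaves out the connection of the domain, which is collected
    in [chr_trace]. Each depends on [G] only through its inverse and so merely rescales under a
    conformal change. *)
Definition hessian_trace X y : 'rV[R]_n :=
  trace_g G (fun i j => pnabla H Phi (cframe i) (pnabla H Phi (cframe j) X) y) y.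

Definition curvature_trace (v : 'rV[R]_n) y : 'rV[R]_n :=
  trace_g G (fun i j => curvature H (Phi y) (partial i Phi y) v (partial j Phi y)) y.

Definition second_form_trace y : 'rV[R]_n :=
  trace_g G (fun i j => pnabla H Phi (cframe i) (partial j Phi) y) y.

Lemma loc_tensionE y :
  loc_tension G H Phi y = second_form_trace y - along (chr_trace G) Phi y.
Proof.
rewrite /loc_tension trace_gD trace_gN trace_along; congr (_ - _).
by rewrite /second_form_trace; refine (eq_trace_g _ _ _) => i j; rewrite along_cframe.
Qed.

Lemma trace_pnabla X y :
  trace_g G (fun i j => pnabla H Phi (nabla G (cframe i) (cframe j)) X y) y =
  pnabla H Phi (chr_trace G) X y.
Proof.
rewrite pnablaE /trace_g.
under eq_bigr do under eq_bigr do rewrite pnablaE scaler_sumr.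
under eq_bigr do rewrite exchange_big/=.
rewrite exchange_big/=; apply: eq_bigr => l _; rewrite mxE scaler_suml.
apply: eq_bigr => i _; rewrite scaler_suml; apply: eq_bigr => j _.
by rewrite nabla_cframe mxE scalerA.
Qed.

Lemma loc_jacobiE X y :
  loc_jacobi G H Phi X y =
  - (hessian_trace X y - pnabla H Phi (chr_trace G) X y - curvature_trace (X y) y).
Proof.
rewrite /loc_jacobi trace_gD trace_gN trace_gD trace_gN trace_pnabla.
congr (- (_ - _ - _)).
by rewrite /curvature_trace; refine (eq_trace_g _ _ _) => i j; rewrite !along_cframe.
Qed.

(** Needed because the Leibniz rule [jacobiZ] is to be applied to the tension field itself. *)
Lemma smooth_tension : smooth_field U (loc_tension G H Phi).
Proof.
apply: (@eq_smooth_field _ _ _ oU _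
  (fun y => second_form_trace y - along (chr_trace G) Phi y)).
  by move=> y _; rewrite loc_tensionE.
apply: (smooth_fieldB oU).
  do 2 apply: (smooth_field_sum oU) => ?.
  apply: (smooth_fieldZ oU); first exact: smooth_invmx.
  by apply: smooth_pnabla_cframe; exact: smooth_field_partial.
apply: (smooth_field_sum oU) => l; apply: (smooth_fieldZ oU); last first.
  exact: smooth_field_partial.
apply: (@eq_smooth_on _ _ _ oU (fun y => \sum_i \sum_j
   invmx (G y) i j * christoffel G y l i j)).
  by move=> y _; rewrite mxE.
do 2 apply: (smooth_on_sum oU) => ?.
apply: (smooth_onM oU); first exact: smooth_invmx.
exact: smooth_christoffel.
Qed.

(** The operator differentiates its argument, so agreement is required on all of [U]. This permits
    replacing the f-tension field by its conformal expression inside the operator. *)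
Lemma eq_loc_jacobi X Y y : (forall z, U z -> X z = Y z) -> U y ->
  loc_jacobi G H Phi X y = loc_jacobi G H Phi Y y.
Proof.
move=> XY Uy.
have E : hessian_trace X y = hessian_trace Y y.
  rewrite /hessian_trace; refine (eq_trace_g _ _ _) => i j.
  by apply: eq_pnabla => // z Uz; exact: eq_pnabla.
by rewrite !loc_jacobiE E (XY y Uy) (eq_pnabla _ XY Uy).
Qed.

Lemma trace_partial_pnabla (F : 'rV[R]_m -> R) X y : U y ->
  trace_g G (fun i j => partial i F y *: pnabla H Phi (cframe j) X y) y =
  pnabla H Phi (grad G F) X y.
Proof.
move=> Uy; rewrite pnablaE /trace_g exchange_big/=; apply: eq_bigr => j _.
rewrite mxE scaler_suml; apply: eq_bigr => i _.
by rewrite scalerA (invmx_sym sG).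
Qed.

(** Two product rules give F times the second derivative of X, two cross terms and the second
    derivatives of F times X. The cross terms have equal traces because the inverse metric is
    symmetric, whence the factor 2; the second derivatives of F join the derivative of F along
    [chr_trace] to form the Laplacian. *)
Lemma jacobiZ F X y : smooth_on U F -> smooth_field U X -> U y ->
  loc_jacobi G H Phi (fun z => F z *: X z) y =
  F y *: loc_jacobi G H Phi X y - laplacian G F y *: X y
  - 2 *: pnabla H Phi (grad G F) X y.
Proof.
move=> sF sX Uy; rewrite !loc_jacobiE.
have -> : curvature_trace (F y *: X y) y = F y *: curvature_trace (X y) y.
  rewrite /curvature_trace -trace_gZ; refine (eq_trace_g _ _ _) => i j.
  by rewrite curvatureZ//; exact: PhiV.
have -> : hessian_trace (fun z => F z *: X z) y =
    F y *: hessian_trace X y +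
    trace_g G (fun i j => partial i (partial j F) y) y *: X y +
    2 *: pnabla H Phi (grad G F) X y.
  have -> : 2 *: pnabla H Phi (grad G F) X y =
     trace_g G (fun i j => partial j F y *: pnabla H Phi (cframe i) X y) y +
     trace_g G (fun i j => partial i F y *: pnabla H Phi (cframe j) X y) y.
    have -> : trace_g G (fun i j =>
          partial j F y *: pnabla H Phi (cframe i) X y) y =
        trace_g G (fun i j => partial i F y *: pnabla H Phi (cframe j) X y) y.
      rewrite /trace_g exchange_big/=.
      by do 2 apply: eq_bigr => ? _; rewrite (invmx_sym sG).
    by rewrite trace_partial_pnabla// scaler_nat mulr2n.
  rewrite /hessian_trace -trace_gZ -trace_gZl -!trace_gD.
  refine (eq_trace_g _ _ _) => i j.
  transitivity (pnabla H Phi (cframe i)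
      (fun z => F z *: pnabla H Phi (cframe j) X z + partial j F z *: X z) y).
    by apply: eq_pnabla => // z Uz; exact: pnabla_cframeZ.
  rewrite pnabla_cframeD//; last 2 first.
  - by apply: (smooth_fieldZ oU) => //; exact: smooth_pnabla_cframe.
  - by apply: (smooth_fieldZ oU) => //; exact: smooth_on_partial.
  rewrite !pnabla_cframeZ//; last 2 first.
  - exact: smooth_on_partial.
  - exact: smooth_pnabla_cframe.
  by rewrite -!addrA [X in _ + X = _]addrC -!addrA [X in _ + X = _]addrCA.
rewrite pnablaZr// (laplacianE oU sG sF Uy).
set T := trace_g _ _ _; set D := along _ F y.
move: (hessian_trace _ _) (curvature_trace _ _) => A C.
move: (pnabla _ _ _ _ _) (pnabla _ _ _ _ _) (X y) => P Q x.
by apply/rowP => a; rewrite !mxE; ring.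
Qed.

End Metric.

(** * The weights [L] and [F] and the identity in one pair of charts *)

Section BiFHarmonic.
Variable G : 'rV[R]_m -> 'M[R]_m.
Hypothesis sG : smooth_metric U G.
Variable f : 'rV[R]_m -> R.
Hypotheses (sf : smooth_on U f) (f_gt0 : forall y, U y -> 0 < f y).
Hypothesis m_neq2 : m <> 2%N.

Let L y := f y `^ (2 / (m%:R - 2)).
Let F y := f y `^ (m%:R / (m%:R - 2)).
Let Gb y := L y *: G y.

Let dm : m%:R - 2 != 0 :> R.
Proof. by rewrite subr_eq0 eqr_nat; exact/eqP. Qed.

Let sL : smooth_on U L.
Proof. by move=> k; exact: Ck_powR. Qed.

Let sF : smooth_on U F.
Proof. by move=> k; exact: Ck_powR. Qed.

Let L_gt0 y : U y -> 0 < L y.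
Proof. by move=> Uy; exact/powR_gt0/f_gt0. Qed.

Let L_neq0 y : U y -> L y != 0.
Proof. by move=> Uy; rewrite gt_eqF// L_gt0. Qed.

Let FE y : U y -> F y = f y * L y.
Proof.
move=> Uy; have fy := f_gt0 Uy.
(* Here f is written as f^1, and 1 + 2/(m-2) = m/(m-2). *)
rewrite /F /L -{2}(powRr1 (ltW fy)) -powRD; last by rewrite (gt_eqF fy) implybT.
by congr (_ `^ _); field.
Qed.

(** Since grad L / L = 2/(m-2) grad f / f, the coefficient (2-m)/2 becomes exactly -1 over f. *)
Let grad_weight y : U y ->
  f y *: (((2 - m%:R) / 2 / L y) *: grad G L y) = - grad G f y.
Proof.
move=> Uy; have fy := f_gt0 Uy.
apply/rowP => i; rewrite !mxE !mulr_sumr -sumrN; apply: eq_bigr => j _.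
have -> : partial j L y =
    2 / (m%:R - 2) * f y `^ (2 / (m%:R - 2) - 1) * partial j f y.
  by have [_] := is_derive_powR_comp (2 / (m%:R - 2)) fy
    (smooth_on_derivable (i := j) sf Uy).
have fL : f y * f y `^ (2 / (m%:R - 2) - 1) = L y.
  rewrite -{1}(powRr1 (ltW fy)) -powRD; last by rewrite (gt_eqF fy) implybT.
  by rewrite addrCA subrr addr0.
move: (partial _ _ _) (invmx _ _ _) => p q.
transitivity ((2 - m%:R) / (m%:R - 2) / L y * q * p *
  (f y * f y `^ (2 / (m%:R - 2) - 1))); first by field; rewrite L_neq0.
by rewrite fL; field; rewrite L_neq0.
Qed.

Lemma chr_trace_weight y : U y ->
  F y *: chr_trace Gb y = f y *: chr_trace G y - grad G f y.
Proof.
move=> Uy; rewrite (chr_trace_conformal oU sG sL L_neq0 Uy) scalerA FE//.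
by rewrite mulfK ?L_neq0// scalerDr grad_weight.
Qed.

Lemma trace_weight (W : normedModType R) (B : 'I_m -> 'I_m -> W) y : U y ->
  F y *: trace_g Gb B y = f y *: trace_g G B y.
Proof.
move=> Uy; rewrite (trace_conformal oU sG sL L_neq0 _ Uy) scalerA FE//.
by rewrite mulfK ?L_neq0.
Qed.

Lemma f_tension_conformal y : U y ->
  loc_f_tension G H Phi f y = F y *: loc_tension Gb H Phi y.
Proof.
move=> Uy; rewrite /loc_f_tension !loc_tensionE !scalerBr.
rewrite [in RHS]/second_form_trace trace_weight// -addrA; congr (_ + _).
(* [along] sees its direction only through the value at y; freezing it there makes the linearity
   lemmas for constant fields applicable. *)
rewrite -[F y *: along _ _ _]/(F y *: along (fun=> chr_trace Gb y) Phi y).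
by rewrite -alongZ chr_trace_weight// alongB alongZ opprB addrC.
Qed.

Lemma jacobi_conformal X y : U y ->
  f y *: loc_jacobi G H Phi X y - pnabla H Phi (grad G f) X y =
  F y *: loc_jacobi Gb H Phi X y.
Proof.
move=> Uy; rewrite !loc_jacobiE !scalerN !scalerBr.
rewrite [in RHS]/hessian_trace [in RHS]/curvature_trace !trace_weight//.
have -> : F y *: pnabla H Phi (chr_trace Gb) X y =
   f y *: pnabla H Phi (chr_trace G) X y - pnabla H Phi (grad G f) X y.
  rewrite (@pnabla_value (chr_trace Gb) (fun=> chr_trace Gb y))// -pnablaZl.
  by rewrite chr_trace_weight// pnablaBl pnablaZl.
rewrite -/(hessian_trace G X y) -/(curvature_trace G (X y) y).
move: (hessian_trace _ _ _) (curvature_trace _ _ _) => A C.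
move: (pnabla _ _ _ _ _) (pnabla _ _ _ _ _) => P Q.
by apply/rowP => a; rewrite !mxE; ring.
Qed.

Lemma bi_f_tension_conformal y : U y ->
  loc_bi_f_tension G H Phi f y = F y *: loc_f_bitension Gb H Phi F y.
Proof.
move=> Uy; rewrite /loc_bi_f_tension addrC -opprB jacobi_conformal//.
rewrite (eq_loc_jacobi _ f_tension_conformal Uy).
have sGb : smooth_metric U Gb by exact: smooth_metric_conformal.
rewrite (jacobiZ sGb sF (smooth_tension sGb) Uy).
rewrite /loc_f_bitension /loc_bitension -scalerN; congr (_ *: _).
by rewrite scalerN; apply/rowP => a; rewrite !mxE; ring.
Qed.

End BiFHarmonic.

End AlongMap.

(** * Passage to manifolds *)

Section Charts.
Variables (R : realType) (m n : nat) (M : manifold R m) (N : manifold R n).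

(** Within the open set [cimg c], the image is the preimage of W under [param c]. As [param c] is
    only continuous at points of that image, the argument runs through neighbourhoods. *)
Lemma open_coord_image (c : chart R m M) (W : set M) :
  open W -> open (Defs.coord c @` (dom c `&` W)).
Proof.
move=> oW; rewrite openE => _ [p [cp Wp] <-].
have n1 : nbhs (Defs.coord c p) (Defs.coord c @` dom c).
  by apply: open_nbhs_nbhs; split; [exact: cimg_open|exists p].
have n2 : nbhs (Defs.coord c p) (param c @^-1` W).
  by apply: (param_cont cp); rewrite coordK//; exact: open_nbhs_nbhs.
rewrite /interior; apply: filterS (filterI n1 n2) => _ [[q cq <-] Wq].
by exists q => //; split=> //; move: Wq; rewrite /= coordK.
Qed.

Lemma open_chart_overlap (phi : smap M N) (c : chart R m M) (d : chart R n N) :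
  open (Defs.coord c @` (dom c `&` phi @^-1` dom d)).
Proof.
apply: open_coord_image; apply: open_comp; last exact: dom_open.
by move=> p _; exact: smap_cont.
Qed.

End Charts.

Lemma smooth_metric_in (R : realType) k (P : manifold R k) (g : metric P)
    (c : chart R k P) :
  atlas c -> smooth_metric (cimg c) (metric_in g c).
Proof.
move=> Ac; split=> [i j|_ [p cp <-]|_ [p cp <-]]; first exact: gram_smooth.
(* Positive definiteness gives a trivial kernel: v G = 0 forces v G v^T = 0. *)
- rewrite /metric_in coordK// -row_free_unit; apply: inj_row_free => v vG.
  apply/eqP; apply: contraT => v0; have := gram_pos g Ac cp v0.
  by rewrite vG mul0mx mxE ltxx.
- by rewrite /metric_in coordK// gram_sym.
Qed.

Section Conformal.
Variables (R : realType) (m n : nat) (M : manifold R m) (N : manifold R n).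
Variables (g : metric M) (h : metric N) (f : posfun M) (phi : smap M N).

Lemma bi_f_tension_conformal_field (hm : m <> 2%N) :
  let F := pospow f (m%:R / (m%:R - 2)) in
  let gbar := conformal (pospow f (2 / (m%:R - 2))) g in
  field_eq phi (bi_f_tension f phi g h)
               (field_scale F (f_bitension F phi gbar h)).
Proof.
move=> F gbar c d p Ac Ad cp dp.
(* The local identity is applied on the part of the chart [c] that [phi] sends into the domain of
   [d]. There [pospow] and [conformal] unfold to the local weights, up to [coordK] at p. *)
pose U := Defs.coord c @` (dom c `&` phi @^-1` dom d).
have Uc : U `<=` cimg c by move=> _ [q [cq _] <-]; exists q.
have Up : U (Defs.coord c p) by exists p.
have sG : smooth_metric U (metric_in g c).
  have [sGc uG tG] := smooth_metric_in g Ac.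
  split=> [i j|y /Uc|y /Uc]; [|exact: uG|exact: tG].
  exact: smooth_on_subset Uc (sGc i j).
have PhiV y : U y -> cimg d (map_in phi c d y).
  by move=> [q [cq dq] <-]; exists (phi q) => //; rewrite /map_in coordK.
have sf : smooth_on U (fun_in f c).
  exact: smooth_on_subset Uc (posfun_smooth f Ac).
have oU : open U by exact: open_chart_overlap.
have oV : open (cimg d) by exact: cimg_open.
have := bi_f_tension_conformal oU oV
  (smooth_metric_in h Ad) (smap_smooth phi Ac Ad) PhiV sG sf
  (fun y _ => posfun_gt0 f _) hm Up.
by rewrite /fun_in coordK.
Qed.

Lemma bi_f_harmonic_conformal (hm : m <> 2%N) :
  bi_f_harmonic f phi g h <->
  f_biharmonic (pospow f (m%:R / (m%:R - 2))) phi
    (conformal (pospow f (2 / (m%:R - 2))) g) h.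
Proof.
split=> H c d p Ac Ad cp dp; have := bi_f_tension_conformal_field hm Ac Ad cp dp.
  rewrite (H c d p Ac Ad cp dp) /field_scale => /esym/eqP.
  by rewrite scaler_eq0 gt_eqF ?pospow_gt0//= => /eqP.
by move=> ->; rewrite /field_scale (H c d p Ac Ad cp dp) scaler0.
Qed.

(** For the converse: applying two inverse conformal changes returns the original function and
    metric only pointwise, not as the same records. *)
Lemma eq_f_biharmonic (f' : posfun M) (g' : metric M) :
  (forall p, f p = f' p) -> (forall c p, gram g c p = gram g' c p) ->
  f_biharmonic f phi g h <-> f_biharmonic f' phi g' h.
Proof.
move=> ff gg.
have E c d p : f_bitension f phi g h c d p = f_bitension f' phi g' h c d p.
  rewrite /f_bitension.
  have -> : fun_in f c = fun_in f' c by apply/funext => y; exact: ff.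
  by have -> : metric_in g c = metric_in g' c by apply/funext => y; exact: gg.
by split=> H c d p Ac Ad cp dp; rewrite -(H c d p Ac Ad cp dp) E.
Qed.

End Conformal.

(** * Vanishing of both fields on a domain of dimension zero *)

Section DimensionZero.
Variables (R : realType) (n : nat) (H : 'rV[R]_n -> 'M[R]_n).
Variables (G : 'rV[R]_0 -> 'M[R]_0) (Phi : 'rV[R]_0 -> 'rV[R]_n).
Variable f : 'rV[R]_0 -> R.

Lemma pnabla_dim0 V X y : pnabla H Phi V X y = 0.
Proof. by rewrite pnablaE big_ord0. Qed.

Lemma loc_jacobi_dim0 X y : loc_jacobi G H Phi X y = 0.
Proof. by rewrite /loc_jacobi /trace_g big_ord0 oppr0. Qed.

Lemma loc_f_bitension_dim0 y : loc_f_bitension G H Phi f y = 0.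
Proof.
rewrite /loc_f_bitension /loc_bitension loc_jacobi_dim0 pnabla_dim0.
by rewrite /laplacian /divergence big_ord0 oppr0 scale0r !scaler0 !addr0.
Qed.

Lemma loc_bi_f_tension_dim0 y : loc_bi_f_tension G H Phi f y = 0.
Proof.
by rewrite /loc_bi_f_tension loc_jacobi_dim0 pnabla_dim0 scaler0 oppr0 addr0.
Qed.

End DimensionZero.

Theorem theorem1p1 (R : realType) (m n : nat)
    (M : manifold R m) (N : manifold R n) (g : metric M) (h : metric N)
    (f : posfun M) (phi : smap M N) (hm : m <> 2%N) :
  let F := pospow f (m%:R / (m%:R - 2)) in
  let gbar := conformal (pospow f (2 / (m%:R - 2))) g in
  field_eq phi (bi_f_tension f phi g h)
               (field_scale F (f_bitension F phi gbar h)) /\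
  (bi_f_harmonic f phi g h <-> f_biharmonic F phi gbar h) /\
  (f_biharmonic f phi g h <->
   bi_f_harmonic (pospow f ((m%:R - 2) / m%:R)) phi
     (conformal (pospow f (- (2 / m%:R))) g) h).
Proof.
move=> F gbar; split; first exact: bi_f_tension_conformal_field.
split; first exact: bi_f_harmonic_conformal.
(* For m = 0 the quotients by m take the default value 0, so the new function is the constant 1,
   from which f cannot be recovered. Both harmonicity conditions hold anyway, since the fields are
   built from empty sums over coordinate directions. *)
have [m0|m0] := eqVneq m 0%N.
  rewrite {}/F {}/gbar; move: M g f phi hm; rewrite {}m0 => M g f phi _.
  split=> _ c d p _ _ _ _.
    exact: loc_bi_f_tension_dim0.
  exact: loc_f_bitension_dim0.
have mR : m%:R != 0 :> R by rewrite pnatr_eq0.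
have m2R : m%:R - 2 != 0 :> R by rewrite subr_eq0 eqr_nat; exact/eqP.
apply: iff_trans (iff_sym (bi_f_harmonic_conformal _ _ _ _ hm)).
(* Two identities between exponents remain: the product of (m-2)/m and m/(m-2) is 1, which restores
   f, and the product of (m-2)/m and 2/(m-2) is 2/m, which cancels the exponent -2/m of the
   conformal factor and restores g. *)
apply: eq_f_biharmonic => [p|c p] /=.
  rewrite -powRrM [X in _ `^ X](_ : _ = 1); last by field; rewrite ?mR ?m2R.
  by rewrite powRr1// ltW// posfun_gt0.
rewrite scalerA -powRrM -powRD; last by rewrite (gt_eqF (posfun_gt0 _ _)) implybT.
by rewrite [X in _ `^ X](_ : _ = 0) ?powRr0 ?scale1r//; field; rewrite ?mR ?m2R.
Qed.
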